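(* Let $G$ be a right-angled Artin group that is not abelian. Then $\mathcal{DP}(G,\mathrm{ab})$, the Diophantine Problem in $G$ with abelianisation constraints, is undecidable.
   Context: **Right-angled Artin groups.** Let $\Gamma$ be a finite undirected graph with no loops and no multiple edges. The right-angled Artin group (RAAG) $G\Gamma$ is the group generated by the vertices of $\Gamma$, subject to the relations $uv=vu$ for every edge $(u,v)$ of $\Gamma$. **Equations.** Let $G$ be a group with a finite generating set. A finite system of equations in $G$ over variables $\mathbf{x}=\{X_1,\dots,X_k\}$ is a finite subset $\mathcal{E}=\{w_1,\dots,w_n\}$ of the free product $G\ast F(\mathbf{x})$; constants from $G$ are given as words over the fixed generators and their inverses. A solution is a homomorphism $\phi:G\ast F(\mathbf{x})\to G$ which is the identity on $G$ and satisfies $\phi(w_1)=\dots=\phi(w_n)=1$. **The problem $\mathcal{DP}(G,\mathrm{ab})$.** Let $\mathrm{ab}:G\to G^{\mathrm{ab}}=G/G'$ be the abelianisation map. An instance of $\mathcal{DP}(G,\mathrm{ab})$ consists of a finite system $\mathcal{E}$ of equations in $G$ on variables $X_1,\dots,X_k$ together with a finite system $\Theta$ of equations in the group $G^{\mathrm{ab}}$ on the same variables. The question is whether $\mathcal{E}$ has a solution $(g_1,\dots,g_k)\in G^k$ such that $(\mathrm{ab}(g_1),\dots,\mathrm{ab}(g_k))$ satisfies $\Theta$ in $G^{\mathrm{ab}}$. The problem is decidable if there is an algorithm answering this question for every instance, and undecidable otherwise. *)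

(* Defs.v *)
From HB Require Import structures.
From mathcomp Require Import all_boot.
From mathcomp Require Import boolp.

Set Implicit Arguments.
Unset Strict Implicit.
Unset Printing Implicit Defensive.

Local Open Scope group_scope.
Local Open Scope quotient_scope.

(* A letter (s, b) stands for s if b = false and for s^-1 if b = true. *)
Definition word (S : Type) := seq (S * bool).

Definition word_inv S (w : word S) : word S := rev [seq (l.1, ~~ l.2) | l <- w].

Definition word_eval (G : groupType) S (f : S -> G) (w : word S) : G :=
  \prod_(l <- w) (if l.2 then (f l.1)^-1 else f l.1).

Section Raag.
Variables (V : finType) (e : rel V).

Inductive raag_eq : word V -> word V -> Prop :=
| raag_eq_refl u : raag_eq u u
| raag_eq_sym u v : raag_eq u v -> raag_eq v u
| raag_eq_trans u v w : raag_eq u v -> raag_eq v w -> raag_eq u w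
| raag_eq_cat u u' v v' :
    raag_eq u u' -> raag_eq v v' -> raag_eq (u ++ v) (u' ++ v')
| raag_eq_cancel s b : raag_eq [:: (s, b); (s, ~~ b)] [::]
| raag_eq_comm s t : e s t ->
    raag_eq [:: (s, false); (t, false)] [:: (t, false); (s, false)].

Definition raag_eqb : rel (word V) := fun u v => `[< raag_eq u v >].

Lemma raag_eqb_refl : reflexive raag_eqb.
Proof. by move=> u; apply/asboolP; apply: raag_eq_refl. Qed.

Lemma raag_eqb_sym : symmetric raag_eqb.
Proof. by move=> u v; apply/asboolP/asboolP; apply: raag_eq_sym. Qed.

Lemma raag_eqb_trans : transitive raag_eqb.
Proof.
by move=> v u w /asboolP uv /asboolP vw; apply/asboolP/(raag_eq_trans uv vw).
Qed.

Canonical raag_equiv := EquivRel raag_eqb raag_eqb_refl raag_eqb_sym raag_eqb_trans.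

Definition raag := {eq_quot raag_equiv}.
HB.instance Definition _ := Choice.on raag.

Definition raag_class (w : word V) : raag := \pi_raag w.

Lemma raag_classP u v : raag_class u = raag_class v <-> raag_eq u v.
Proof.
split=> [/eqquotP/asboolP //|uv]; by apply/eqquotP/asboolP.
Qed.

Lemma raag_reprK (x : raag) : raag_class (repr x) = x.
Proof. exact: reprK. Qed.

Lemma raag_class_surj (x : raag) : exists w, x = raag_class w.
Proof. by exists (repr x); rewrite raag_reprK. Qed.

Lemma raag_repr_class w : raag_eq (repr (raag_class w)) w.
Proof. by apply/raag_classP; rewrite raag_reprK. Qed.

Lemma word_invK : involutive (@word_inv V).
Proof.
move=> w; rewrite /word_inv map_rev revK -map_comp -[RHS]map_id.
by apply: eq_map => -[s b] /=; rewrite negbK.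
Qed.

Lemma word_inv_cat (u v : word V) : word_inv (u ++ v) = word_inv v ++ word_inv u.
Proof. by rewrite /word_inv map_cat rev_cat. Qed.

Lemma raag_eq_mulV w : raag_eq (w ++ word_inv w) [::].
Proof.
elim: w => [|[s b] w IH]; first exact: raag_eq_refl.
rewrite -cat1s word_inv_cat -catA [w ++ _]catA.
apply: (raag_eq_trans _ (raag_eq_cancel s b)).
apply: (@raag_eq_cat _ [:: (s, b)] _ [:: (s, ~~ b)]); first exact: raag_eq_refl.
exact: (raag_eq_cat IH (raag_eq_refl _)).
Qed.

Lemma raag_eq_Vmul w : raag_eq (word_inv w ++ w) [::].
Proof. by rewrite -{2}[w]word_invK; apply: raag_eq_mulV. Qed.

Lemma raag_eq_inv u v : raag_eq u v -> raag_eq (word_inv u) (word_inv v).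
Proof.
move=> uv; have H : raag_eq (word_inv u ++ (v ++ word_inv v)) (word_inv u).
  rewrite -[X in raag_eq _ X]cats0.
  exact: raag_eq_cat (raag_eq_refl _) (raag_eq_mulV _).
apply: raag_eq_trans (raag_eq_sym H) _; rewrite catA.
apply: (@raag_eq_cat _ [::]); last exact: raag_eq_refl.
apply: (raag_eq_trans _ (raag_eq_Vmul u)).
exact: raag_eq_cat (raag_eq_refl _) (raag_eq_sym uv).
Qed.

Definition raag_one : raag := raag_class [::].
Definition raag_mul (x y : raag) : raag := raag_class (repr x ++ repr y).
Definition raag_inv (x : raag) : raag := raag_class (word_inv (repr x)).

Lemma raag_mulE u v :
  raag_mul (raag_class u) (raag_class v) = raag_class (u ++ v).
Proof. by apply/raag_classP/raag_eq_cat; apply: raag_repr_class. Qed.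

Lemma raag_invE u : raag_inv (raag_class u) = raag_class (word_inv u).
Proof. by apply/raag_classP/raag_eq_inv; apply: raag_repr_class. Qed.

Lemma raag_mulA : associative raag_mul.
Proof.
move=> x y z; case: (raag_class_surj x) (raag_class_surj y) (raag_class_surj z).
by move=> u -> [v ->] [w ->]; rewrite !raag_mulE catA.
Qed.

Lemma raag_mul1 : left_id raag_one raag_mul.
Proof. by move=> x; case: (raag_class_surj x) => u ->; rewrite raag_mulE. Qed.

Lemma raag_mulr1 : right_id raag_one raag_mul.
Proof.
by move=> x; case: (raag_class_surj x) => u ->; rewrite raag_mulE cats0.
Qed.

Lemma raag_mulV : left_inverse raag_one raag_inv raag_mul.
Proof.
move=> x; case: (raag_class_surj x) => u ->; rewrite raag_invE raag_mulE.
exact/raag_classP/raag_eq_Vmul.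
Qed.

Lemma raag_mulrV : right_inverse raag_one raag_inv raag_mul.
Proof.
move=> x; case: (raag_class_surj x) => u ->; rewrite raag_invE raag_mulE.
exact/raag_classP/raag_eq_mulV.
Qed.

HB.instance Definition _ :=
  isGroup.Build raag raag_mulA raag_mul1 raag_mulr1 raag_mulV raag_mulrV.

Definition raag_gen (s : V) : raag := raag_class [:: (s, false)].

End Raag.

Section Abelianisation.
Variable G : groupType.

Inductive derived : G -> Prop :=
| derived1 : derived 1
| derivedM x y : derived x -> derived y -> derived (x * y)
| derivedV x : derived x -> derived x^-1
| derivedR x y : derived [~ x, y].

Definition ab_eqb : rel G := fun x y => `[< derived (x^-1 * y) >].

Lemma ab_eqb_refl : reflexive ab_eqb.
Proof. by move=> x; apply/asboolP; rewrite mulVg; apply: derived1. Qed.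

Lemma ab_eqb_sym : symmetric ab_eqb.
Proof.
by move=> x y; apply/asboolP/asboolP => /derivedV; rewrite invgM invgK.
Qed.

Lemma ab_eqb_trans : transitive ab_eqb.
Proof.
move=> y x z /asboolP xy /asboolP yz; apply/asboolP.
by have := derivedM xy yz; rewrite -mulgA mulVKg.
Qed.

Canonical ab_equiv := EquivRel ab_eqb ab_eqb_refl ab_eqb_sym ab_eqb_trans.

Definition abelianisation := {eq_quot ab_equiv}.
HB.instance Definition _ := Choice.on abelianisation.

Definition ab (x : G) : abelianisation := \pi_abelianisation x.

Lemma abP x y : ab x = ab y <-> derived (x^-1 * y).
Proof.
split=> [/eqquotP/asboolP //|xy]; by apply/eqquotP/asboolP.
Qed.

Lemma ab_surj (a : abelianisation) : exists x, a = ab x.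
Proof. by exists (repr a); rewrite /ab reprK. Qed.

Lemma ab_repr x : derived ((repr (ab x))^-1 * x).
Proof. by apply/abP; rewrite /ab reprK. Qed.

Lemma derivedJ x y : derived x -> derived (x ^ y).
Proof.
by move=> dx; have := derivedM dx (derivedR x y); rewrite /commg mulVKg.
Qed.

Definition ab_one : abelianisation := ab 1.
Definition ab_mul (a b : abelianisation) : abelianisation := ab (repr a * repr b).
Definition ab_inv (a : abelianisation) : abelianisation := ab (repr a)^-1.

Lemma ab_mulE x y : ab_mul (ab x) (ab y) = ab (x * y).
Proof.
apply/abP; rewrite invgM; set a := repr (ab x); set b := repr (ab y).
have -> : b^-1 / a * (x * y) = (a^-1 * x) ^ b * (b^-1 * y).
  by rewrite conjgE !mulgA mulgK.
by apply: derivedM; [apply: derivedJ|]; apply: ab_repr.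
Qed.

Lemma ab_invE x : ab_inv (ab x) = ab x^-1.
Proof.
apply/abP; rewrite invgK; set a := repr _.
have -> : a * x^-1 = ((a^-1 * x)^-1) ^ x^-1.
  by rewrite conjgE invgM !invgK !mulgA mulgV mul1g.
by apply/derivedJ/derivedV/ab_repr.
Qed.

Lemma ab_mulA : associative ab_mul.
Proof.
move=> a b c; case: (ab_surj a) (ab_surj b) (ab_surj c) => x -> [y ->] [z ->].
by rewrite !ab_mulE mulgA.
Qed.

Lemma ab_mul1 : left_id ab_one ab_mul.
Proof. by move=> a; case: (ab_surj a) => x ->; rewrite ab_mulE mul1g. Qed.

Lemma ab_mulr1 : right_id ab_one ab_mul.
Proof. by move=> a; case: (ab_surj a) => x ->; rewrite ab_mulE mulg1. Qed.

Lemma ab_mulV : left_inverse ab_one ab_inv ab_mul.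
Proof. by move=> a; case: (ab_surj a) => x ->; rewrite ab_invE ab_mulE mulVg. Qed.

Lemma ab_mulrV : right_inverse ab_one ab_inv ab_mul.
Proof. by move=> a; case: (ab_surj a) => x ->; rewrite ab_invE ab_mulE mulgV. Qed.

HB.instance Definition _ :=
  isGroup.Build abelianisation ab_mulA ab_mul1 ab_mulr1 ab_mulV ab_mulrV.

Lemma ab_monoid_morphism : monoid_morphism ab.
Proof. by split=> // x y; rewrite -ab_mulE. Qed.

HB.instance Definition _ :=
  isUMagmaMorphism.Build G abelianisation ab ab_monoid_morphism.

End Abelianisation.

(* An element of G * F(X_1, ..., X_k) is given by a word whose letters are
   generators of G (inl s) or variables (inr i). The words in dp_abeqs are read
   in G^ab * F(X_1, ..., X_k), inl s being the image of s in G^ab. *)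
Record dp_instance (S : finType) := DPInstance {
  dp_nvars : nat;
  dp_eqs : seq (word (S + 'I_dp_nvars));
  dp_abeqs : seq (word (S + 'I_dp_nvars)) }.

Definition eqn_eval (S : finType) (G : groupType) (gen : S -> G) k
    (g : 'I_k -> G) (w : word (S + 'I_k)) : G :=
  word_eval (fun l => match l with inl s => gen s | inr i => g i end) w.

Definition dp_solvable (S : finType) (G : groupType) (gen : S -> G)
    (I : dp_instance S) : Prop :=
  exists g : 'I_(dp_nvars I) -> G,
    {in dp_eqs I, forall w, eqn_eval gen g w = 1} /\
    {in dp_abeqs I, forall w, eqn_eval (@ab G \o gen) (@ab G \o g) w = 1}.

Local Close Scope group_scope.

(* Partial recursive functions of arity n; in mr_prec the recursion variable
   comes first, h(0, x) = f(x) and h(m+1, x) = g(m, h(m, x), x). *)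
Inductive murec : nat -> Type :=
| mr_zero n : murec n
| mr_succ : murec 1
| mr_proj n : 'I_n -> murec n
| mr_comp n k : murec k -> ('I_k -> murec n) -> murec n
| mr_prec n : murec n -> murec n.+2 -> murec n.+1
| mr_mu n : murec n.+1 -> murec n.

Fixpoint computes n (f : murec n) : n.-tuple nat -> nat -> Prop :=
  match f in murec n return n.-tuple nat -> nat -> Prop with
  | mr_zero _ => fun _ y => y = 0
  | mr_succ => fun x y => y = (thead x).+1
  | mr_proj _ i => fun x y => y = tnth x i
  | mr_comp _ k f gs => fun x y =>
      exists z : k.-tuple nat,
        (forall i, computes (gs i) x (tnth z i)) /\ computes f z y
  | mr_prec _ f g => fun x y =>
      exists h : nat -> nat,
        [/\ computes f (behead_tuple x) (h 0),
            forall m, m < thead x ->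
              computes g [tuple of m :: h m :: behead_tuple x] (h m.+1)
          & y = h (thead x)]
  | mr_mu _ f => fun x y =>
      computes f [tuple of y :: x] 0 /\
      forall m, m < y -> exists v, computes f [tuple of m :: x] v.+1
  end.

(* The algorithm need not halt on numbers that do not code an instance. *)
Definition rec_decidable I (code : I -> nat) (P : I -> Prop) : Prop :=
  exists f : murec 1, forall i,
    (P i -> computes f [tuple code i] 1) /\
    (~ P i -> computes f [tuple code i] 0).

(* Cantor pairing *)
Definition npair (x y : nat) : nat := 'C((x + y).+1, 2) + y.

Definition code_seq T (c : T -> nat) : seq T -> nat :=
  foldr (fun a n => (npair (c a) n).+1) 0.

Definition code_letter (S : finType) k (l : (S + 'I_k) * bool) : nat :=
  npair (match l.1 with
         | inl s => npair 0 (enum_rank s)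
         | inr i => npair 1 i
         end) l.2.

Definition dp_code (S : finType) (I : dp_instance S) : nat :=
  npair (dp_nvars I)
    (npair (code_seq (code_seq (@code_letter S _)) (dp_eqs I))
           (code_seq (code_seq (@code_letter S _)) (dp_abeqs I))).

Lemma npair_inj x y x' y' : npair x y = npair x' y' -> x = x' /\ y = y'.
Proof.
have lt_sum a b c d : a + b < c + d -> npair a b < npair c d.
  move=> lt_s; rewrite /npair.
  apply: (@leq_trans 'C((a + b).+2, 2)); last first.
    by apply: leq_trans (leq_addr _ _); apply: leq_bin2l.
  by rewrite [X in _ < X]binS bin1 ltn_add2l ltnS leq_addl.
move=> eq_p; have eq_s : x + y = x' + y'.
  by case: (ltngtP (x + y) (x' + y')) => // /lt_sum; rewrite eq_p ltnn.
have eq_y : y = y' by move: eq_p; rewrite /npair eq_s => /addnI.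
by split=> //; move: eq_s; rewrite eq_y => /addIn.
Qed.

Lemma code_seq_inj T (c : T -> nat) : injective c -> injective (code_seq c).
Proof.
move=> c_inj; elim=> [|a s IH] [|b t] //= [] /npair_inj[/c_inj -> /IH ->] //.
Qed.

Lemma code_letter_inj (S : finType) k : injective (@code_letter S k).
Proof.
move=> [a x] [b y] /npair_inj[/= eq_ab eq_xy].
have -> : x = y by case: x y eq_xy => -[].
case: a b eq_ab => [s|i] [t|j] /npair_inj[] //= _ eq_st.
  by rewrite (enum_rank_inj (val_inj eq_st)).
by rewrite (val_inj eq_st).
Qed.

Lemma dp_code_inj (S : finType) : injective (@dp_code S).
Proof.
move=> [k E T] [k' E' T'] /npair_inj[/= eq_k].
case: k' / eq_k E' T' => E' T' /npair_inj[].
have inj := code_seq_inj (code_seq_inj (@code_letter_inj S k)).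
by move=> /inj -> /inj ->.
Qed.

(* Main.v *)
(** Let [a], [b] be two non-adjacent vertices. In the Heisenberg group, a quotient of the
    RAAG in which [a], [b] are the standard generators, commuting elements have collinear
    images in [Z^2]. So, if [X] commutes with [a] and [B] with [b], then [ab X = (x, 0)]
    and [ab B = (0, y)]; an element [W] commuting with [X b] and such that
    [ab W = (z, y)] forces [z = x y]; and if [U] commutes with [a b] then [ab U = ab X ab B]
    forces [x = y]. With witnesses [X = a^x], [B = b^y], [W = (a^x b)^y] and
    [U = (a b)^x], equations with abelianisation constraints thus express
    multiplication, and Lagrange's theorem reduces natural numbers to integers.

    The graphs of recursive functions are Diophantine. Exponentiation is obtained from
    Pell's equation (Matiyasevich). A bounded quantifier over a system in the atoms
    [x = 1], [x = y + z], [x = y z] is eliminated by solving the system modulo numbers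
    [m_i] with large prime factors: if [T] is the factorial of a large number, the
    numbers [m_i = T / i - 1] are pairwise coprime, [T = i] modulo [m_i], and their
    product is the binomial coefficient ['C(T - 1, y)]. A solution modulo a prime factor of [m_i]
    with entries bounded by [u] is a genuine solution, and the bound is enforced by
    divisibility of ['C(W, u + 1)] by the product.

    If [f] decided the problem, the relation "[f] rejects the system coded by [n] with
    its parameter set to [n]" would be Diophantine, hence coded by a system; giving it
    its own code as parameter is contradictory. *)

From HB Require Import structures.
Require Import Defs.
From mathcomp Require Import all_boot all_order all_algebra boolp zify ring.

Set Implicit Arguments.
Unset Strict Implicit.
Unset Printing Implicit Defensive.

Import Order.TTheory GRing.Theory Num.Theory.

(** * Diophantine relations *)

Inductive atom (T : Type) := AOne of T | AAdd of T & T & T | AMul of T & T & T.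

Definition atom_map T U (f : T -> U) (A : atom T) : atom U :=
  match A with
  | AOne i => AOne (f i)
  | AAdd i j k => AAdd (f i) (f j) (f k)
  | AMul i j k => AMul (f i) (f j) (f k)
  end.

Definition atom_sat T (v : T -> nat) (A : atom T) : bool :=
  match A with
  | AOne i => v i == 1
  | AAdd i j k => v i == v j + v k
  | AMul i j k => v i == v j * v k
  end.

Definition sys_sat T (v : T -> nat) (s : seq (atom T)) := all (atom_sat v) s.

Lemma sys_sat_map T U (f : T -> U) v s :
  sys_sat v (map (atom_map f) s) = sys_sat (v \o f) s.
Proof. by rewrite /sys_sat all_map; apply: eq_all => -[]. Qed.

Lemma sys_sat_ext T (v w : T -> nat) s : v =1 w -> sys_sat v s = sys_sat w s.
Proof. by move=> vw; apply: eq_all => -[] *; rewrite /= !vw. Qed.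

Definition env := nat -> nat.

Definition env_sum (v w : env) (i : nat + nat) : nat :=
  match i with inl j => v j | inr j => w j end.

Definition shift (v : env) : env := fun i => v i.+1.

(* The [inl] variables of the system are free, the [inr] ones are bound. *)
Definition dioph (R : env -> Prop) : Prop :=
  exists s, forall v, R v <-> exists w, sys_sat (env_sum v w) s.

(** Variable 0 carries the value and the arguments move up by one, so that quantifying over the
    value composes functions. *)
Definition dfun (f : env -> nat) : Prop := dioph (fun v => v 0 = f (shift v)).

Lemma dioph_iff R R' : (forall v, R v <-> R' v) -> dioph R' -> dioph R.
Proof. by move=> RR' [s sP]; exists s => v; rewrite RR'. Qed.

Lemma dioph_ren (r : nat -> nat) R : dioph R -> dioph (fun v => R (v \o r)).
Proof.
move=> [s sP].
exists (map (atom_map (fun i => match i with inl j => inl (r j) | inr j => inr j end)) s).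
move=> v; rewrite sP; split=> -[w ws]; exists w; move: ws;
  by rewrite sys_sat_map; congr is_true; apply: sys_sat_ext => -[].
Qed.

Lemma dioph_and P Q : dioph P -> dioph Q -> dioph (fun v => P v /\ Q v).
Proof.
move=> [s sP] [t tQ].
(* The bound variables of the two systems are kept apart by parity. *)
pose f b (i : nat + nat) : nat + nat :=
  match i with inl j => inl j | inr j => inr (j.*2 + b) end.
exists (map (atom_map (f false)) s ++ map (atom_map (f true)) t) => v.
rewrite sP tQ; split=> [[[w ws] [z zt]]|[w]].
  exists (fun i => if odd i then z i./2 else w i./2).
  rewrite /sys_sat all_cat -!/(sys_sat _ _) !sys_sat_map.
  apply/andP; split; [move: ws|move: zt]; congr is_true;
  by apply: sys_sat_ext => -[]//= j; rewrite ?addn0 ?addn1 /= odd_double ?uphalf_double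
    ?doubleK.
rewrite /sys_sat all_cat -!/(sys_sat _ _) !sys_sat_map => /andP[ws wt].
split; [exists (fun i => w (i.*2 + false)); move: ws|exists (fun i => w (i.*2 + true));
  move: wt];
  by congr is_true; apply: sys_sat_ext => -[].
Qed.

Definition mix (w v : env) : env := fun i => if odd i then v i./2 else w i./2.

(** All even-numbered variables are quantified at once: the witnesses and the old bound variables
    interleave into a single environment. *)
Lemma dioph_exs R : dioph R -> dioph (fun v => exists w, R (mix w v)).
Proof.
move=> [s sP].
pose f (i : nat + nat) : nat + nat :=
  match i with inl j => if odd j then inl j./2 else inr j./2.*2
             | inr j => inr (j.*2.+1) end.
exists (map (atom_map f) s) => v; split.
  move=> [w /sP[z zs]]; exists (mix w z); rewrite sys_sat_map.
  move: zs; congr is_true; apply: sys_sat_ext => -[j|j] /=; rewrite /mix.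
    by case: ifP => //= _; rewrite odd_double doubleK.
  by rewrite /= odd_double uphalf_double.
move=> [z]; rewrite sys_sat_map => zs.
exists (fun i => z i.*2); apply/sP; exists (fun i => z i.*2.+1).
move: zs; congr is_true; apply: sys_sat_ext => -[j|j] //=; rewrite /mix.
by case: ifP.
Qed.

Lemma dioph_ex (P : nat -> env -> Prop) :
  dioph (fun v => P (v 0) (fun i => v i.+1)) -> dioph (fun v => exists x, P x v).
Proof.
move=> dP; have := dioph_exs (dioph_ren (fun i => if i is j.+1 then j.*2.+1 else 0) dP).
apply: dioph_iff => v; rewrite /mix /=.
split=> [[x Px]|[w]].
  exists (fun=> x); rewrite /comp /=.
  suff -> : (fun i => if ~~ odd i.*2 then v (uphalf i.*2) else x) = v by [].
  by apply: funext => i; rewrite odd_double uphalf_double.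
rewrite /comp /= => Pw; exists (w 0); move: Pw.
suff -> : (fun i => if ~~ odd i.*2 then v (uphalf i.*2) else w (uphalf i.*2)) = v by [].
by apply: funext => i; rewrite odd_double uphalf_double.
Qed.

Lemma dioph_conj n (P : nat -> env -> Prop) :
  (forall j, j < n -> dioph (P j)) -> dioph (fun v => forall j, j < n -> P j v).
Proof.
elim: n => [|n IH] dP.
  by exists [::] => v; split=> // _; exists v.
apply: dioph_iff (dioph_and (IH _) (dP n _)) => //; last by move=> j /ltnW; apply: dP.
move=> v; split=> [H|[H Hn] j]; last by rewrite ltnS leq_eqVlt => /predU1P[->|/H].
by split=> [j jn|]; apply: H => //; rewrite ltnS ltnW.
Qed.

Lemma dioph_one i : dioph (fun v => v i = 1).
Proof.
exists [:: AOne (inl i)] => v; split=> [vi|[w]]; last by rewrite /= andbT => /eqP.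
by exists v; rewrite /= vi.
Qed.

Lemma dioph_atomD i j k : dioph (fun v => v i = v j + v k).
Proof.
exists [:: AAdd (inl i) (inl j) (inl k)] => v; split=> [vi|[w]].
  by exists v; rewrite /= vi eqxx.
by rewrite /= andbT => /eqP.
Qed.

Lemma dioph_atomM i j k : dioph (fun v => v i = v j * v k).
Proof.
exists [:: AMul (inl i) (inl j) (inl k)] => v; split=> [vi|[w]].
  by exists v; rewrite /= vi eqxx.
by rewrite /= andbT => /eqP.
Qed.

Lemma dfun0 : dfun (fun=> 0).
Proof. by apply: dioph_iff (dioph_atomD 0 0 0) => v; lia. Qed.

Lemma dfun_var i : dfun (fun v => v i).
Proof.
have H : dioph (fun v => exists z, z = z + z /\ v 0 = z + v i.+1).
  by apply: dioph_ex; apply: dioph_and; [apply: (dioph_atomD 0 0 0)|apply: (dioph_atomD 1 0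
    i.+2)].
apply: dioph_iff H => v; rewrite /shift; split=> [->|[z []]]; last by lia.
by exists 0.
Qed.

Lemma dfun_ren r f : dfun f -> dfun (fun v => f (v \o r)).
Proof.
by move=> df; have := dioph_ren (fun j => if j is k.+1 then (r k).+1 else 0) df.
Qed.

Lemma dioph_eq f g : dfun f -> dfun g -> dioph (fun v => f v = g v).
Proof.
move=> df dg.
have : dioph (fun v => exists x, x = f v /\ x = g v).
  apply: dioph_ex; apply: dioph_and; [exact: df|exact: dg].
by apply: dioph_iff => v; split=> [->|[x [-> ->]]] //; exists (g v).
Qed.

Lemma dioph_sub1 (R : nat -> env -> Prop) f :
  dioph (fun v => R (v 0) (fun i => v i.+1)) -> dfun f -> dioph (fun v => R (f v) v).
Proof.
move=> dR df.
have : dioph (fun v => exists x, x = f v /\ R x v).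
  apply: dioph_ex; apply: dioph_and; [exact: df|exact: dR].
apply: dioph_iff => v; split=> [|[x [-> //]]]; by exists (f v).
Qed.

Lemma dioph_rel2 (R : nat -> nat -> Prop) f g :
  dioph (fun v => R (v 0) (v 1)) -> dfun f -> dfun g ->
  dioph (fun v => R (f v) (g v)).
Proof.
move=> dR df dg; apply: (dioph_sub1 (R := fun x v => R x (g v))) df.
apply: (dioph_sub1 (R := fun x v => R (v 0) x)); last exact: (dfun_ren succn dg).
exact: (dioph_ren (fun i => if i is j.+1 then 0 else 1) dR).
Qed.

Lemma dioph_rel3 (R : nat -> nat -> nat -> Prop) f g h :
  dioph (fun v => R (v 0) (v 1) (v 2)) -> dfun f -> dfun g -> dfun h ->
  dioph (fun v => R (f v) (g v) (h v)).
Proof.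
move=> dR df dg dh; apply: (dioph_sub1 (R := fun x v => R x (g v) (h v))) df.
apply: (dioph_sub1 (R := fun x v => R (v 0) x (h (shift v)))); last exact: (dfun_ren succn dg).
apply: (dioph_sub1 (R := fun x v => R (v 1) (v 0) x)).
  exact: (dioph_ren (fun i => match i with 0 => 2 | 1 => 1 | _ => 0 end) dR).
exact: (dfun_ren (fun i => i.+2) dh).
Qed.

Lemma dioph_rel4 (R : nat -> nat -> nat -> nat -> Prop) f g h k :
  dioph (fun v => R (v 0) (v 1) (v 2) (v 3)) ->
  dfun f -> dfun g -> dfun h -> dfun k ->
  dioph (fun v => R (f v) (g v) (h v) (k v)).
Proof.
move=> dR df dg dh dk; apply: (dioph_sub1 (R := fun x v => R x (g v) (h v) (k v))) df.
apply: (dioph_sub1 (R := fun x v => R (v 0) x (h (shift v)) (k (shift v))));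
  last exact: (dfun_ren succn dg).
apply: (dioph_sub1 (R := fun x v => R (v 1) (v 0) x (k (shift (shift v)))));
  last exact: (dfun_ren (fun i => i.+2) dh).
apply: (dioph_sub1 (R := fun x v => R (v 2) (v 1) (v 0) x)).
  exact: (dioph_ren (fun i => match i with 0 => 3 | 1 => 2 | 2 => 1 | _ => 0 end) dR).
exact: (dfun_ren (fun i => i.+3) dk).
Qed.

Lemma dfun_comp1 (F : nat -> nat) f :
  dioph (fun v => v 0 = F (v 1)) -> dfun f -> dfun (fun v => F (f v)).
Proof.
move=> dF df; apply: (dioph_rel2 (R := fun x y => x = F y)) => //.
  exact: dfun_var.
exact: (dfun_ren succn df).
Qed.

Lemma dfun_comp2 (F : nat -> nat -> nat) f g :
  dioph (fun v => v 0 = F (v 1) (v 2)) -> dfun f -> dfun g -> dfun (fun v => F (f v) (g v)).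
Proof.
move=> dF df dg; apply: (dioph_rel3 (R := fun x y z => x = F y z)) => //.
- exact: dfun_var.
- exact: (dfun_ren succn df).
- exact: (dfun_ren succn dg).
Qed.

Lemma dfunD f g : dfun f -> dfun g -> dfun (fun v => f v + g v).
Proof. exact/dfun_comp2/dioph_atomD. Qed.

Lemma dfunM f g : dfun f -> dfun g -> dfun (fun v => f v * g v).
Proof. exact/dfun_comp2/dioph_atomM. Qed.

Lemma dfunS f : dfun f -> dfun (fun v => (f v).+1).
Proof.
apply: (dfun_comp1 (F := succn)).
have : dioph (fun v => exists x, x = 1 /\ v 0 = v 1 + x).
  by apply: dioph_ex; apply: dioph_and; [apply: (dioph_one 0)|apply: (dioph_atomD 1 2 0)].
by apply: dioph_iff => v; split=> [->|[x [-> ->]]]; [exists 1; rewrite addn1|rewrite addn1].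
Qed.

Lemma dfun_const n : dfun (fun=> n).
Proof. by elim: n => [|n IH]; [apply: dfun0|apply: (dfunS IH)]. Qed.

(** Hook of [dio], redefined below once further relations are known to be Diophantine. *)
Ltac dio_rel := fail.
Ltac dio :=
  cbv beta;
  match goal with
  | |- dfun _ =>
      first [ assumption | apply: dfun_var | apply: dfun_const
            | apply: dfunS; dio | apply: dfunD; dio | apply: dfunM; dio
            | dio_rel; dio ]
  | |- dioph _ =>
      first [ assumption
            | apply: dioph_ex; dio | apply: dioph_and; dio
            | apply: dioph_eq; dio
            | dio_rel; dio ]
  end.

Lemma dioph_le f g : dfun f -> dfun g -> dioph (fun v => f v <= g v).
Proof.
apply: (dioph_rel2 (R := fun x y => is_true (x <= y))).
have : dioph (fun v => exists x, v 1 = v 0 + x) by dio.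
apply: dioph_iff => v; split=> [le01|[x ->]]; last exact: leq_addr.
by exists (v 1 - v 0); rewrite subnKC.
Qed.

Lemma dioph_dvd f g : dfun f -> dfun g -> dioph (fun v => f v %| g v).
Proof.
apply: (dioph_rel2 (R := fun x y => is_true (x %| y))).
have : dioph (fun v => exists x, v 1 = x * v 0) by dio.
by apply: dioph_iff => v; split=> /dvdnP.
Qed.

(** Multiples of [d] are added on both sides because a quotient may be negative. The case [d = 0] is
    included. *)
Lemma eqn_modP m n d : reflect (exists q r, m + q * d = n + r * d) (m == n %[mod d]).
Proof.
apply: (iffP eqP) => [mn|[q [r E]]]; last first.
  by have := congr1 (modn^~ d) E; rewrite ![_ + _ * d]addnC !modnMDl.
by exists (n %/ d), (m %/ d); rewrite {1}(divn_eq m d) {2}(divn_eq n d) mn; ring.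
Qed.

Lemma dioph_eqmod f g h :
  dfun f -> dfun g -> dfun h -> dioph (fun v => f v = g v %[mod h v]).
Proof.
apply: (dioph_rel3 (R := fun x y z => x = y %[mod z])).
have : dioph (fun v => exists q r, v 0 + q * v 2 = v 1 + r * v 2) by dio.
by apply: dioph_iff => v; split=> [/eqP/eqn_modP //|/eqn_modP/eqP].
Qed.

Ltac dio_rel ::= first [ apply: dioph_le | apply: dioph_dvd | apply: dioph_eqmod ].

(** * Pell's equation *)

Local Open Scope ring_scope.

(** The coordinates [X_n], [Y_n] of [(a + sqrt (a^2 - 1)) ^ n] with respect to [1] and
    [sqrt (a^2 - 1)]. *)
Fixpoint pell (a : int) (n : nat) : int * int :=
  if n is m.+1 then
    (a * (pell a m).1 + (a ^+ 2 - 1) * (pell a m).2, (pell a m).1 + a * (pell a m).2)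
  else (1, 0).

Notation pellX a n := (pell a n).1.
Notation pellY a n := (pell a n).2.

Lemma pell_eq a n : pellX a n ^+ 2 - (a ^+ 2 - 1) * pellY a n ^+ 2 = 1.
Proof. by elim: n => [|n IH] /=; [ring|rewrite -[RHS]IH; ring]. Qed.

Lemma pellXD a m n : pellX a (m + n) = pellX a m * pellX a n + (a ^+ 2 - 1) * pellY a m *
  pellY a n
  /\ pellY a (m + n) = pellX a m * pellY a n + pellY a m * pellX a n.
Proof.
elim: m => [|m [IHx IHy]]; first by rewrite add0n /=; split; ring.
by rewrite addSn /= IHx IHy; split; ring.
Qed.

Lemma pellX_double a n : pellX a (n + n) = 2 * pellX a n ^+ 2 - 1.
Proof. by rewrite (pellXD a n n).1 -[x in _ = _ - x](pell_eq a n); ring. Qed.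

Lemma pellY_double a n : pellY a (n + n) = 2 * pellX a n * pellY a n.
Proof. by rewrite (pellXD a n n).2; ring. Qed.

(** The subtraction formula for indices: a unit of norm 1 is inverted by conjugation, that is, by
    changing the sign of [Y]. *)
Lemma pellX_opp a m n : pellX a m = pellX a (m + n) * pellX a n - (a ^+ 2 - 1) * pellY a (m +
  n) * pellY a n.
Proof.
by rewrite (pellXD a m n).1 (pellXD a m n).2 -[LHS]mulr1 -[x in _ * x = _](pell_eq a n); ring.
Qed.

Lemma pell_ge0 a n : 1 < a -> (0 < pellX a n) /\ (0 <= pellY a n).
Proof. by move=> a1; elim: n => [|n [IHx IHy]] //=; split; nia. Qed.

Lemma pellX_gt0 a n : 1 < a -> 0 < pellX a n.
Proof. by move=> /(@pell_ge0 a n)[]. Qed.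

Lemma pellY_ge0 a n : 1 < a -> 0 <= pellY a n.
Proof. by move=> /(@pell_ge0 a n)[]. Qed.

Lemma pellY_ge a n : 1 < a -> n%:Z <= pellY a n.
Proof.
move=> a1; elim: n => [|n IH] //=.
by have := pellX_gt0 n a1; have := pellY_ge0 n a1; nia.
Qed.

Lemma pellX_ltS a n : 2 < a -> 3 * pellX a n <= pellX a n.+1.
Proof.
move=> a2; have a1 : 1 < a by lia.
by have := pellX_gt0 n a1; have := pellY_ge0 n a1; rewrite /=; nia.
Qed.

Lemma pellX_lt a m n : 2 < a -> (m < n)%N -> 3 * pellX a m <= pellX a n.
Proof.
move=> a2; elim: n => // n IH; rewrite ltnS leq_eqVlt => /predU1P[->|/IH mn].
  exact: pellX_ltS.
by have := pellX_ltS n a2; have := @pellX_gt0 a m; lia.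
Qed.

Lemma pellY_lb a n : 1 < a -> a ^+ n <= pellY a n.+1.
Proof.
move=> a1; elim: n => [|n IH]; first by rewrite expr0 /=; lia.
rewrite exprS -[pell a _]/(_, _); set y := pellY a n.+1 in IH *; set x := pellX a n.+1.
by rewrite /=; have := @pellX_gt0 a n.+1 a1; rewrite -/x; nia.
Qed.

Lemma pell_complete a x y : 1 < a -> 0 <= x -> 0 <= y ->
  x ^+ 2 - (a ^+ 2 - 1) * y ^+ 2 = 1 -> exists n, x = pellX a n /\ y = pellY a n.
Proof.
move=> a1; have [k] := ubnP `|y|%N; elim: k x y => // k IH x y yk x0 y0 E.
have [y00|ypos] : y = 0 \/ 0 < y by lia.
  by exists 0%N; split=> //=; rewrite y00 in E; nia.
(* Descent: [(x', y')] is the solution [(x, y)] multiplied by the inverse [a - sqrt (a^2 - 1)] of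
   the fundamental unit. *)
set y' := a * y - x; set x' := a * x - (a ^+ 2 - 1) * y.
have y'0 : 0 <= y'.
  suff : x <= a * y by rewrite /y'; lia.
  by rewrite -(@ler_pXn2r _ 2) ?nnegrE //; nia.
have y'y : y' < y.
  suff : (a - 1) * y < x by rewrite /y'; lia.
  by rewrite -(@ltr_pXn2r _ 2) ?nnegrE //; nia.
have x'0 : 0 <= x'.
  suff : (a ^+ 2 - 1) * y <= a * x by rewrite /x'; lia.
  have : x ^+ 2 = 1 + (a ^+ 2 - 1) * y ^+ 2 by rewrite -[z in z + _]E; ring.
  rewrite -(@ler_pXn2r _ 2) ?nnegrE //; last 2 first.
  - by nia.
  - by nia.
  by rewrite exprMn [(a * x) ^+ 2]exprMn => ->; nia.
have E' : x' ^+ 2 - (a ^+ 2 - 1) * y' ^+ 2 = 1 by rewrite /x' /y' -[RHS]E; ring.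
have [|n [nx ny]] := IH x' y' _ x'0 y'0 E'; first by lia.
exists n.+1; rewrite /= -nx -ny /x' /y'; split; ring.
Qed.

(** [X_n] and [Y_n] are polynomials in [a] with integer coefficients. *)
Lemma pell_congr a b n :
  (a - b %| pellX a n - pellX b n)%Z /\ (a - b %| pellY a n - pellY b n)%Z.
Proof.
elim: n => [|n [/dvdzP[p Hp] /dvdzP[q Hq]]] /=; first by rewrite !subrr.
have -> : pellX a n = pellX b n + p * (a - b) by rewrite -Hp; ring.
have -> : pellY a n = pellY b n + q * (a - b) by rewrite -Hq; ring.
split; apply/dvdzP.
  exists (pellX b n + (a + b) * pellY b n + a * p + (a ^+ 2 - 1) * q); ring.
exists (pellY b n + p + a * q); ring.
Qed.

Lemma pell1_congr a n : (a - 1 %| pellY a n - n%:Z)%Z.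
Proof.
have [_] := pell_congr a 1 n; suff -> : pellY 1 n = n%:Z by [].
suff [] : pellX 1 n = 1 /\ pellY 1 n = n%:Z by [].
by elim: n => [|n [IHx IHy]] //=; rewrite IHx IHy; split; [ring|lia].
Qed.

(** Modulo [X_n], adding [2 n] to the index changes the sign of [X], and so does reflecting the
    index in [n]. Hence every index folds into [[0, n]] up to a sign, and with the plus sign the
    index is known up to sign modulo [4 n]. *)
Lemma pellXn_congr a n j : (0 < n)%N ->
  exists2 i, (i <= n)%N &
    [/\ (pellX a n %| pellX a j - pellX a i)%Z & ((4 * n)%N%:Z %| j%:Z - i%:Z)%Z \/ ((4 *
      n)%N%:Z %| j%:Z + i%:Z)%Z]
    \/ (i < n)%N /\ (pellX a n %| pellX a j + pellX a i)%Z.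
Proof.
move=> n0; have add2 k : (pellX a n %| pellX a (n + n + k) + pellX a k)%Z.
  rewrite (pellXD _ _ k).1 pellX_double pellY_double; apply/dvdzP.
  exists (2 * pellX a n * pellX a k + (a ^+ 2 - 1) * 2 * pellY a n * pellY a k); ring.
have opp2 k m : (k + m = n + n)%N -> (pellX a n %| pellX a k + pellX a m)%Z.
  move=> km; rewrite (pellX_opp a k m) km pellX_double pellY_double; apply/dvdzP.
  exists (2 * pellX a n * pellX a m - (a ^+ 2 - 1) * 2 * pellY a n * pellY a m); ring.
have [k] := ubnP j; elim: k j => // k IH j jk.
have [jn|nj] := leqP j n.
  by exists j => //; left; split; [rewrite subrr|left; rewrite subrr].
have [jn2|nj2] := leqP j (n + n).
  exists (n + n - j)%N; first by lia.
  right; split; first by lia.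
  by apply: opp2; lia.
have [jn3|nj3] := ltnP j (n + n + n).
  exists (j - (n + n))%N; first by lia.
  right; split; first by lia.
  by have := add2 (j - (n + n))%N; rewrite subnKC // ltnW.
have [jn4|nj4] := leqP j (4 * n).
  exists (4 * n - j)%N; first by lia.
  left; split; last by right; apply/dvdzP; exists 1; lia.
  have [m jE] : exists m, j = (n + n + m)%N by exists (j - (n + n))%N; lia.
  have E := add2 m; have F := @opp2 m (4 * n - j)%N ltac:(lia).
  by rewrite {1}jE; have := rpredB E F; congr (_ %| _)%Z; ring.
have [m jE] : exists m, j = (n + n + (n + n + m))%N by exists (j - 4 * n)%N; lia.
have [i le_in H] := IH m ltac:(lia).
exists i => //.
have D : (pellX a n %| pellX a j - pellX a m)%Z.
  by rewrite jE; have := rpredB (add2 (n + n + m)%N) (add2 m); congr (_ %| _)%Z; ring.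
case: H => [[H C]|[lt_in H]]; [left|right; split=> //].
  split; first by rewrite (_ : pellX a j - pellX a i = pellX a j - pellX a m + (pellX a m -
    pellX a i)); [apply: rpredD|ring].
  case: C => /dvdzP[q Hq]; [left|right]; apply/dvdzP; exists (q + 1); lia.
rewrite (_ : pellX a j + pellX a i = pellX a j - pellX a m + (pellX a m + pellX a i));
  [exact: rpredD|ring].
Qed.

Lemma dvdz_small (d m : int) : (d %| m)%Z -> `|m| < d -> m = 0.
Proof.
move=> /dvdzP[q ->]; rewrite normrM => H.
have [->|q0] := eqVneq q 0; first by rewrite mul0r.
by exfalso; nia.
Qed.

(** Let [X_j] be congruent to [X_k] up to sign, with [k <= n]. Since [X] at least triples at each
    step, neither the sum nor the difference of [X_i] and [X_k] can be a multiple of [X_n], unless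
    the sign is plus and [k = i]. An index equal to [n] is treated apart, as [X_n] vanishes modulo
    itself. *)
Lemma pellX_inj a n i j : 2 < a -> (0 < i <= n)%N -> (pellX a n %| pellX a i - pellX a j)%Z ->
  ((4 * n)%N%:Z %| j%:Z - i%:Z)%Z \/ ((4 * n)%N%:Z %| j%:Z + i%:Z)%Z.
Proof.
move=> a2 /andP[i0 le_in] ij; have a1 : 1 < a by lia.
have n0 : (0 < n)%N by lia.
have [k le_kn [[jk C]|[lt_kn jk]]] := pellXn_congr a j n0; last first.
  have ik : (pellX a n %| pellX a i + pellX a k)%Z.
    by have := rpredD ij jk; congr (_ %| _)%Z; ring.
  have := pellX_gt0 i a1; have := pellX_gt0 k a1 => xi xk; exfalso.
  have kn := pellX_lt a2 lt_kn.
  move: le_in; rewrite leq_eqVlt => /predU1P[Ei|lt_in].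
    have kk : (pellX a n %| pellX a k)%Z.
      by have := rpredB ik (dvdzz (pellX a n)); rewrite Ei; congr (_ %| _)%Z; ring.
    by move/dvdz_small: kk => {ik ij} kk; lia.
  by move/dvdz_small: ik => {jk ij} ik; have := pellX_lt a2 lt_in; lia.
suff <- : k = i by [].
have {jk} ik : (pellX a n %| pellX a i - pellX a k)%Z.
  by have := rpredD ij jk; congr (_ %| _)%Z; ring.
have xi := pellX_gt0 i a1; have xk := pellX_gt0 k a1.
have [ltki|ltik|//] := ltngtP k i.
- have ki := pellX_lt a2 ltki.
  have [Ei|lt_in] := eqVneq i n.
    have kk : (pellX a n %| pellX a k)%Z.
      by have := rpredB (dvdzz (pellX a n)) ik; rewrite Ei; congr (_ %| _)%Z; ring.
    by move/dvdz_small: kk => {ik ij C}; rewrite -Ei; lia.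
  have xin : 3 * pellX a i <= pellX a n by apply: pellX_lt => //; lia.
  by move/dvdz_small: ik => {ij C} ik; lia.
- have ki := pellX_lt a2 ltik.
  have [Ek|lt_kn] := eqVneq k n.
    have kk : (pellX a n %| pellX a i)%Z.
      by have := rpredD ik (dvdzz (pellX a n)); rewrite Ek; congr (_ %| _)%Z; ring.
    by move/dvdz_small: kk => {ik ij C}; rewrite -Ek; lia.
  have xkn : 3 * pellX a k <= pellX a n by apply: pellX_lt => //; lia.
  by move/dvdz_small: ik => {ij C} ik; lia.
Qed.

(** By the subtraction formula [Y_i] also divides [Y_(n - i)], so the index descends as in Euclidean
    division. For [n < i] divisibility forces [Y_n = 0], hence [n = 0]. *)
Lemma pellY_dvd_index a i n : 1 < a -> (0 < i)%N -> (pellY a i %| pellY a n)%Z -> (i %| n)%N.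
Proof.
move=> a1 i0; have [k] := ubnP n; elim: k n => // k IH n nk yn.
have xyi := pell_eq a i.
have [ni|le_in] := ltnP n i.
  have [->//|n0] := posnP n.
  have : pellY a n = 0.
    apply: dvdz_small yn _; rewrite ger0_norm ?pellY_ge0 //.
    elim: i ni {IH xyi i0} => // i IHi; rewrite ltnS leq_eqVlt => /predU1P[->|/IHi ni] /=.
      by have := pellX_gt0 i a1; have := pellY_ge0 i a1; nia.
    by have := pellX_gt0 i a1; have := pellY_ge0 i a1; nia.
  by have := pellY_ge n a1; lia.
suff : (i %| n - i)%N by rewrite dvdn_subl.
apply: IH; first by lia.
have /dvdzP[q Hq] := yn; apply/dvdzP.
have := pellXD a (n - i) i; rewrite subnK // => -[Hx Hy].
exists (pellX a i * q - pellX a n).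
have -> : pellY a (n - i) = pellX a i * pellY a n - pellY a i * pellX a n.
  rewrite Hx Hy.
  transitivity (pellY a (n - i) * (pellX a i ^+ 2 - (a ^+ 2 - 1) * pellY a i ^+ 2));
    last by ring.
  by rewrite xyi mulr1.
by rewrite Hq; ring.
Qed.

(** The binomial expansion of [(X_i + Y_i sqrt (a^2 - 1)) ^ q] modulo [Y_i] and [Y_i ^ 2]. The
    second congruence is multiplied by [X_i] to avoid the exponent [q - 1]. *)
Lemma pell_muln a i q :
  (pellY a i %| pellX a (q * i) - pellX a i ^+ q)%Z /\
  (pellY a i ^+ 2 %| pellX a i * pellY a (q * i) - q%:Z * pellX a i ^+ q * pellY a i)%Z.
Proof.
elim: q => [|q [/dvdzP[r Hr] /dvdzP[s Hs]]].
  by rewrite mul0n /= expr0; split; [rewrite subrr|rewrite mulr0 !mul0r subrr].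
rewrite mulSn addnC !(pellXD _ _ i).1 !(pellXD _ _ i).2.
have Ex : pellX a (q * i) = pellX a i ^+ q + r * pellY a i by rewrite -Hr; ring.
split; apply/dvdzP.
  exists (r * pellX a i + (a ^+ 2 - 1) * pellY a (q * i)); rewrite Ex [_ ^+ q.+1]exprS; ring.
exists (pellX a i * r + s * pellX a i).
transitivity (pellX a i * pellX a (q * i) * pellY a i + (s * pellY a i ^+ 2 + q%:Z * pellX a i
  ^+ q * pellY a i) * pellX a i - q.+1%:Z * pellX a i ^+ q.+1 * pellY a i).
  rewrite -Hs; ring.
rewrite Ex [_ ^+ q.+1]exprS intS; ring.
Qed.

Lemma eqn_mod_dvdz m n d : (m = n %[mod d])%N <-> (d%:Z %| m%:Z - n%:Z)%Z.
Proof.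
rewrite -eqz_mod_dvd; split=> [E|/eqP]; last by rewrite !modz_nat => -[].
by rewrite !modz_nat E.
Qed.

Lemma pell_coprime a n : coprimez (pellX a n) (pellY a n).
Proof.
apply/coprimezP; exists (pellX a n, - (a ^+ 2 - 1) * pellY a n) => /=.
by rewrite -[RHS](pell_eq a n); ring.
Qed.

(** Write [n = q i]. By [pell_muln], [Y_i ^ 2] divides [q X_i ^ q Y_i], and [X_i] is prime to [Y_i],
    so [Y_i] divides [q]. *)
Lemma pellY_sq_dvd a i n : 1 < a -> (0 < i)%N ->
  (pellY a i ^+ 2 %| pellY a n)%Z -> (pellY a i %| n%:Z)%Z.
Proof.
move=> a1 i0 y2n; have yn : (pellY a i %| pellY a n)%Z by apply: dvdz_trans y2n;
  apply: dvdz_exp.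
have /dvdnP[q qE] := pellY_dvd_index a1 i0 yn.
rewrite qE in y2n *; have [_ H] := pell_muln a i q.
have := rpredB (dvdz_mull (pellX a i) y2n) H; rewrite opprB addrC subrK.
have y0 : pellY a i != 0 by have := pellY_ge i a1; lia.
rewrite expr2 dvdz_mul2r // Gauss_dvdzl; last by rewrite coprimez_sym coprimezXl ?pell_coprime.
by rewrite PoszM => /dvdz_mulr->.
Qed.

Lemma pellY_sq_dvd_mul a i q : 1 < a -> (pellY a i %| q%:Z)%Z ->
  (pellY a i ^+ 2 %| pellY a (q * i))%Z.
Proof.
move=> a1 yq; have [_ H] := pell_muln a i q.
rewrite -(@Gauss_dvdzr _ (pellX a i)); last first.
  by rewrite coprimezXl // coprimez_sym pell_coprime.
rewrite -[_ * _](subrK (q%:Z * pellX a i ^+ q * pellY a i)) rpredD //.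
by rewrite expr2 dvdz_mul // dvdz_mulr.
Qed.

Definition pell_rel (a k x y : nat) := x%:Z = pellX a k /\ y%:Z = pellY a k.

Definition pell_sol (a x y : nat) := (x * x + y * y = (a * a) * (y * y) + 1)%N.

Lemma pell_solP a x y : (1 < a)%N -> pell_sol a x y <-> exists n, pell_rel a n x y.
Proof.
move=> a1; rewrite /pell_sol; split=> [E|[n [xE yE]]].
  have [n [xE yE]] := @pell_complete a x y ltac:(lia) ltac:(lia) ltac:(lia)
    ltac:(rewrite !expr2; lia).
  by exists n.
by have := pell_eq a n; rewrite -xE -yE; lia.
Qed.

(** Let [(x, y)], [(u, v)] be the solutions of index [i], [n] for [a], and [(s, t)] that of index
    [j] for [b]. From [b = 1] modulo [4 y] one gets [t = j], so [j = k] modulo [4 y]. From [b = a]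
    modulo [u = X_n] one gets [X_j = X_i] modulo [X_n], so [j] is [i] or [- i] modulo [4 n]. As
    [y ^ 2] divides [v], [y] divides [n]; so [k] is [i] or [- i] modulo [4 y], and [0 < i, k <= y]
    leaves [k = i]. *)
Lemma pell_relP a k x y : (2 < a)%N -> (0 < k)%N ->
  pell_rel a k x y <-> (k <= y)%N /\
  exists u v s t b, pell_sol a x y /\ pell_sol a u v /\ pell_sol b s t /\
    (2 <= b)%N /\ (b = 1 %[mod 4 * y])%N /\ (b = a %[mod u])%N /\ (1 <= v)%N /\
    (y * y %| v)%N /\ (s = x %[mod u])%N /\ (t = k %[mod 4 * y])%N.
Proof.
move=> a2 k0; have a1 : (1 < a)%N by lia.
split=> [[xE yE]|].
  have ky : (k <= y)%N by have := @pellY_ge a k; lia.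
  (* The factor [y] gives [y ^ 2] dividing [v]; the factor 2 makes [v] even, so that [u] is prime to
     [4 y] and [b] exists by the Chinese remainder theorem. *)
  split=> //; pose n := (2 * y * k)%N.
  have nat_pell c m : (1 < c)%N -> exists p q, pell_rel c m p q.
    move=> c1; have [cx cy] := @pell_ge0 c m ltac:(lia).
    by exists `|pellX c m|%N, `|pellY c m|%N; split; lia.
  have [u [v uvn]] := nat_pell a n a1.
  have v0 : (1 <= v)%N.
    have n0 : (0 < n)%N by rewrite /n !muln_gt0; lia.
    by have := @pellY_ge a n; case: uvn; lia.
  have yv : (y * y %| v)%N.
    have : (pellY a k ^+ 2 %| pellY a n)%Z.
      by apply: pellY_sq_dvd_mul; [lia|rewrite -yE PoszM dvdz_mull].
    by case: uvn => _ <-; rewrite -yE expr2 -PoszM.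
  have cop : coprime u (4 * y).
    have [uE vE] := uvn.
    have cuv : coprime u v by have := pell_coprime a n; rewrite -uE -vE.
    have /coprime_dvdr cu : (4 * y %| v * v * v)%N.
      have v2 : (2 %| v)%N.
        have : (2 %| pellY a n)%Z.
          by rewrite /n -mulnA mul2n -addnn pellY_double -mulrA dvdz_mulr.
        by rewrite -vE.
      have vy : (y %| v)%N by apply: dvdn_trans yv; apply: dvdn_mulr.
      by rewrite -[4%N]/(2 * 2)%N !dvdn_mul.
    by apply: cu; rewrite !coprimeMr !cuv.
  have [b0 [b1 [/esym bu /esym b4]]] :
    exists b, (2 <= b)%N /\ (a = b %[mod u])%N /\ (1 = b %[mod 4 * y])%N.
    have u1 : (0 < u)%N by have := @pellX_gt0 a n ltac:(lia); case: uvn; lia.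
    (* The added multiple of both moduli ensures [2 <= b]. *)
    exists (chinese u (4 * y) a 1 + u * (4 * y))%N; split; first by nia.
    by split; [rewrite addnC [(u * _)%N]mulnC modnMDl chinese_modl|rewrite addnC modnMDl
      chinese_modr].
  have [s [t [sE tE]]] := nat_pell b0 k ltac:(lia).
  exists u, v, s, t, b0; do !split=> //.
  - by apply/pell_solP => //; exists k.
  - by apply/pell_solP => //; exists n.
  - by apply/pell_solP; [lia|exists k].
  - apply/eqn_mod_dvdz; rewrite sE xE.
    by move/eqn_mod_dvdz: bu => /dvdz_trans; apply; have [] := pell_congr b0 a k.
  apply/eqn_mod_dvdz; rewrite tE.
  by move/eqn_mod_dvdz: b4 => /dvdz_trans; apply; apply: pell1_congr.
move=> [ky [u [v [s [t [b [/(pell_solP _ _ a1)[i [xE yE]] [/(pell_solP _ _ a1)[n [uE vE]]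
  [st [b1 [b4 [bu [v0 [yv [su tk]]]]]]]]]]]]]]].
have [j [sE tE]] := (pell_solP s t b1).1 st.
suff -> : k = i by [].
have a1' : 1 < a%:Z by lia.
have y0 : (0 < y)%N by clear -ky k0; lia.
have i0 : (0 < i)%N.
  by clear -yE y0; case: i yE => //= yE; lia.
have yn : (y %| n)%N.
  suff : (pellY a i %| n%:Z)%Z by rewrite -yE.
  apply: pellY_sq_dvd => //; rewrite -yE -vE expr2 -PoszM.
  exact: yv.
have n0 : (0 < n)%N.
  by clear -vE v0; case: n vE => //= vE; lia.
have le_in : (i <= n)%N.
  have := dvdn_leq n0 yn; have := pellY_ge i a1'; clear -yE; lia.
have ij : (pellX a n %| pellX a i - pellX a j)%Z.
  rewrite -uE.
  move/eqn_mod_dvdz: bu => bu; have := dvdz_trans bu (pell_congr b a j).1 => H1.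
  move/eqn_mod_dvdz: su => su; rewrite sE xE in su.
  by have := rpredB H1 su; congr (_ %| _)%Z; ring.
have y4 : ((4 * y)%N%:Z %| (4 * n)%N%:Z)%Z by apply: dvdn_mul.
have kj : ((4 * y)%N%:Z %| j%:Z - k%:Z)%Z.
  move/eqn_mod_dvdz: tk => tk; rewrite tE in tk.
  move/eqn_mod_dvdz: b4 => b4; have := dvdz_trans b4 (pell1_congr b j) => H1.
  by have := rpredB tk H1; congr (_ %| _)%Z; ring.
have iy : (i <= y)%N by have := pellY_ge i a1'; clear -yE; lia.
have i0n : (0 < i <= n)%N by rewrite i0.
have a2' : 2 < a%:Z by clear -a2; lia.
have [H|H] := pellX_inj a2' i0n ij.
  have := rpredB (dvdz_trans y4 H) kj => /dvdz_small; clear -k0 i0 iy ky; lia.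
have := rpredB (dvdz_trans y4 H) kj => /dvdz_small; clear -k0 i0 iy ky; lia.
Qed.

Local Close Scope ring_scope.

(** * Exponentials, binomial coefficients and factorials *)

(** The offsets 3 and 1 absorb the hypotheses [2 < a] and [0 < k] of [pell_relP]. *)
Lemma dioph_pell : dioph (fun v => pell_rel (v 0).+3 (v 1).+1 (v 2) (v 3)).
Proof.
apply: dioph_iff (fun v => @pell_relP (v 0).+3 (v 1).+1 (v 2) (v 3) isT isT) _.
rewrite /pell_sol; dio.
Qed.

Lemma dioph_pell_rel f g h k : dfun f -> dfun g -> dfun h -> dfun k ->
  dioph (fun v => pell_rel (f v).+3 (g v).+1 (h v) (k v)).
Proof. exact/(dioph_rel4 (R := fun a b c d => pell_rel a.+3 b.+1 c d))/dioph_pell. Qed.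

Lemma PoszX (m n : nat) : ((m ^ n)%N%:Z = m%:Z ^+ n)%R.
Proof. by elim: n => // n IH; rewrite expnS PoszM IH exprS. Qed.

Section ExpCongr.
Local Open Scope ring_scope.

(** Modulo [2 a m - m^2 - 1] one has [(m - a)^2 = a^2 - 1], so [m - a] can replace the square root
    in [(a + sqrt (a^2 - 1)) ^ n]. *)
Lemma pell_exp_congr a m n :
  (2 * a * m - m ^+ 2 - 1 %| pellX a n - (a - m) * pellY a n - m ^+ n)%Z.
Proof.
elim: n => [|n /dvdzP[q Hq]] /=; first by rewrite mulr0 subr0 subrr.
apply/dvdzP; exists (q * m + pellY a n).
transitivity (m * (pellX a n - (a - m) * pellY a n - m ^+ n) + (2 * a * m - m ^+ 2 - 1) *
  pellY a n).
  rewrite [m ^+ n.+1]exprS; ring.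
rewrite Hq; ring.
Qed.

End ExpCongr.

(** The congruence [pell_exp_congr] determines [m.+1 ^ n.+1] modulo [t], and both sides are below
    [t]. For this the base [(y0 + m).+3] must be large, which is achieved by [y0], itself a Pell
    number of exponential size. The exponent is raised by one because [dioph_pell] needs a positive
    index; hence [m.+1 * z]. *)
Lemma expn_pellP m n z : z = m.+1 ^ n <->
  exists x0 y0 x y t, pell_rel m.+3 n.+2 x0 y0 /\ pell_rel (y0 + m).+3 n.+1 x y /\
    t + m.+1 * m.+1 + 1 = 2 * (y0 + m).+3 * m.+1 /\ (m.+1 * z).+1 <= t /\
    m.+1 * z + y * y0.+2 = x %[mod t].
Proof.
have nat_pell c k : exists p q, pell_rel c.+3 k p q.
  have [cx cy] := @pell_ge0 c.+3 k ltac:(lia).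
  by exists `|pellX c.+3 k|%N, `|pellY c.+3 k|%N; split; lia.
have [x0 [y0 pell0]] := nat_pell m n.+2.
have le_y0 : m.+1 ^ n.+1 <= y0.
  have [_ y0E] := pell0.
  have : ((m.+3 ^ n.+1)%N%:Z <= y0)%R.
    by rewrite y0E PoszX; apply: pellY_lb; lia.
  rewrite lez_nat; apply: leq_trans; rewrite leq_exp2r //; lia.
have [x [y pell1]] := nat_pell (y0 + m) n.+1.
pose t := 2 * (y0 + m).+3 * m.+1 - m.+1 * m.+1 - 1.
have tE : t + m.+1 * m.+1 + 1 = 2 * (y0 + m).+3 * m.+1 by rewrite /t; nia.
have y0t : y0 < t by clear -tE; nia.
have cong : m.+1 ^ n.+1 + y * y0.+2 = x %[mod t].
  case: pell1 => xE yE; apply/eqn_mod_dvdz; rewrite PoszD PoszX PoszM xE yE.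
  have := pell_exp_congr (y0 + m).+3 m.+1 n.+1.
  rewrite (_ : (2 * _ * _ - _ - _)%R = Posz t); last by rewrite expr2; clear -tE; lia.
  rewrite -rpredN; congr (_ %| _)%Z.
  have -> : (y0.+2%:Z = (y0 + m).+3%:Z - m.+1%:Z)%R by clear; lia.
  by ring.
split=> [->|].
  exists x0, y0, x, y, t; rewrite -expnS; do !split => //.
  by apply: leq_ltn_trans y0t.
move=> [x0' [y0' [x' [y' [t' [[_ y0E] [pell1' [tE' [zt cong']]]]]]]]].
have E0 : y0' = y0 by case: pell0 => _; rewrite -y0E => -[].
rewrite E0 in pell1' tE' cong'.
have [Ex Ey] : x' = x /\ y' = y by case: pell1' pell1 => x'E y'E [xE yE];
  clear -xE yE x'E y'E; split; lia.
have Et : t' = t by clear -tE tE'; lia.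
rewrite Ex Ey Et in cong' zt.
have : m.+1 * z + y * y0.+2 == m.+1 ^ n.+1 + y * y0.+2 %[mod t] by rewrite cong' cong.
rewrite eqn_modDr !modn_small //; last exact: leq_ltn_trans y0t.
by rewrite expnS eqn_mul2l => /eqP.
Qed.

Lemma dfun_expS f g : dfun f -> dfun g -> dfun (fun v => (f v).+1 ^ g v).
Proof.
apply: (dfun_comp2 (F := fun m n => m.+1 ^ n)).
apply: dioph_iff (fun v => expn_pellP (v 1) (v 2) (v 0)) _.
have pell1 i j k l := dioph_pell_rel (dfun_var i) (dfunS (dfun_var j)) (dfun_var k) (dfun_var
  l).
have pell2 i j k l m := dioph_pell_rel (dfunD (dfun_var i) (dfun_var j)) (dfun_var k)
  (dfun_var l) (dfun_var m).
do 5 apply: dioph_ex.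
apply: dioph_and; first exact: pell1.
apply: dioph_and; first exact: pell2.
dio.
Qed.

Lemma dfun_divn f g : (forall v, 0 < g v) -> dfun f -> dfun g -> dfun (fun v => f v %/ g v).
Proof.
move=> g0 df dg.
have : dioph (fun v => exists r, f (shift v) = v 0 * g (shift v) + r /\ r.+1 <= g (shift v)).
  have := dfun_ren (fun i => i.+2) df; have := dfun_ren (fun i => i.+2) dg.
  by rewrite /comp /shift => ? ?; dio.
apply: dioph_iff => v; split=> [->|[r [-> rg]]].
  by exists (f (shift v) %% g (shift v)); rewrite -divn_eq ltn_mod.
by rewrite divnMDl // divn_small ?addn0.
Qed.

Lemma dfun_modn f g : (forall v, 0 < g v) -> dfun f -> dfun g -> dfun (fun v => f v %% g v).
Proof.
move=> g0 df dg.
have : dioph (fun v => exists q, f (shift v) = q * g (shift v) + v 0 /\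
  (v 0).+1 <= g (shift v)).
  have := dfun_ren (fun i => i.+2) df; have := dfun_ren (fun i => i.+2) dg.
  by rewrite /comp /shift => ? ?; dio.
apply: dioph_iff => v; split=> [->|[r [-> rg]]].
  by exists (f (shift v) %/ g (shift v)); rewrite -divn_eq ltn_mod.
by rewrite modnMDl modn_small.
Qed.

Lemma digit_sum B k n (c : nat -> nat) : (forall i, c i < B) ->
  (\sum_(i < n) c i * B ^ i) %/ B ^ k %% B = if k < n then c k else 0.
Proof.
move=> cB; have B0 : 0 < B by apply: leq_ltn_trans (cB 0).
elim: k n c cB => [|k IH] [|n] c cB; rewrite ?big_ord0 ?div0n ?mod0n //.
- rewrite big_ord_recl expn0 divn1 muln1 /bump /=.
  under eq_bigr do rewrite expnS mulnCA.
  by rewrite -big_distrr /= addnC mulnC modnMDl modn_small.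
rewrite big_ord_recl expn0 muln1 /bump /= expnS divnMA.
under eq_bigr do rewrite expnS mulnCA.
rewrite -big_distrr /= [_ + _]addnC mulnC divnMDl // (divn_small (cB 0)) addn0.
by rewrite (IH _ (fun i => c i.+1)) ?ltnS.
Qed.

(** With [B = 2 ^ n + 1], larger than every coefficient, the binomial coefficients are the digits of
    [(B + 1) ^ n] in base [B]. *)
Lemma bin_digit n k : 'C(n, k) = ((2 ^ n).+2 ^ n) %/ (2 ^ n).+1 ^ k %% (2 ^ n).+1.
Proof.
have cB i : 'C(n, i) < (2 ^ n).+1.
  rewrite ltnS; have [le_in|/bin_small->//] := leqP i n.
  have := expnDn 1 1 n; rewrite addn1 => ->.
  rewrite (bigD1 (Ordinal (n := n.+1) (m := i) le_in)) //= !exp1n !muln1; exact: leq_addr.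
have -> : (2 ^ n).+2 ^ n = \sum_(i < n.+1) 'C(n, i) * (2 ^ n).+1 ^ i.
  by rewrite -[_.+2]add1n expnDn; apply: eq_bigr => i _; rewrite exp1n mul1n.
rewrite digit_sum //; case: ltnP => // nk; exact: bin_small.
Qed.

Lemma dfun_bin f g : dfun f -> dfun g -> dfun (fun v => 'C(f v, g v)).
Proof.
apply: (dfun_comp2 (F := fun n k => 'C(n, k))).
apply: dioph_iff (_ : forall v, v 0 = 'C(v 1, v 2) <->
  v 0 = ((2 ^ v 1).+2 ^ v 1) %/ (2 ^ v 1).+1 ^ v 2 %% (2 ^ v 1).+1) _.
  by move=> v; rewrite bin_digit.
have d2 : dfun (fun v => 2 ^ v 0) by apply: (dfun_expS (f := fun=> 1)); dio.
apply: (@dfun_modn (fun v => ((2 ^ v 0).+2 ^ v 0) %/ (2 ^ v 0).+1 ^ v 1) (fun v =>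
  (2 ^ v 0).+1)) => //.
  apply: dfun_divn => [v||]; first by rewrite expn_gt0.
    by apply: (dfun_expS (f := fun v => (2 ^ v 0).+1)); dio.
  by apply: (dfun_expS (f := fun v => 2 ^ v 0)); dio.
by dio.
Qed.

(** The falling factorial differs from [r ^ n] by a relative error of at most [n ^ 2 / r], written
    without denominators. *)
Lemma ffact_lower_bound r n : r ^ n * (r - n * n) <= (r ^_ n) * r.
Proof.
elim: n => [|n IH]; first by rewrite subn0 ffactn0.
have [nr|rn] := ltnP (n.+1 * n.+1) r; last by rewrite (eqP rn) muln0.
rewrite ffactnSr expnS; apply: leq_trans (_ : r ^ n * (r - n * n) * (r - n) <= _); last first.
  by rewrite [leqRHS]mulnAC leq_mul2r IH orbT.
rewrite [r * _]mulnC -!mulnA leq_mul2l; apply/orP; right; clear IH.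
have [d ->] : exists d, r = n.+1 * n.+1 + d by exists (r - n.+1 * n.+1); lia.
rewrite addKn.
have -> : n.+1 * n.+1 + d - n * n = n.*2.+1 + d by lia.
have -> : n.+1 * n.+1 + d - n = n * n + n + 1 + d by lia.
nia.
Qed.

Definition fact_base n := n.+2 ^ n.+3.

(** For large [r], [n!] is the integer part of [r ^ n / 'C(r, n)]: the quotient is at least [n!]
    since [n! 'C(r, n)] is a falling factorial, and less than [n! + 1] once [n ^ 2 (n! + 1) < r].
    The number [fact_base n] is such an [r]. *)
Lemma fact_quotP n f : f = n`! <->
  f * 'C(fact_base n, n) <= fact_base n ^ n /\
  (fact_base n ^ n).+1 <= f.+1 * 'C(fact_base n, n).
Proof.
set r := fact_base n; have ffE := bin_ffact r n.
have r0 : 0 < r by rewrite expn_gt0.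
have fr : r ^_ n <= r ^ n.
  elim: (n) => // k IH; rewrite ffactnSr expnSr; apply: leq_mul => //; exact: leq_subr.
have fact_le k : k`! <= k.+1 ^ k.
  elim: k => // k IH; rewrite factS expnS leq_mul // (leq_trans IH) //.
  by case: (k) => // j; rewrite leq_exp2r.
have rn : n * n * (n`!).+1 < r.
  rewrite /r /fact_base -[n.+3]/(2 + n.+1) expnD.
  have := fact_le n; rewrite [n.+2 ^ n.+1]expnS.
  have : n.+1 ^ n <= n.+2 ^ n by case: (n) => // k; rewrite leq_exp2r.
  have : 0 < n.+2 ^ n by rewrite expn_gt0.
  move: (n.+2 ^ n) (n.+1 ^ n) (n`!) => a b c; rewrite expnS expn1; nia.
have lb := ffact_lower_bound r n.
have C0 : 0 < 'C(r, n).
  rewrite bin_gt0; apply: leq_trans (ltnW rn); have := fact_gt0 n; nia.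
have main : r ^ n < (n`!).+1 * 'C(r, n).
  rewrite ltnNge; apply/negP => le_P.
  have P0 : 0 < r ^ n by rewrite expn_gt0 r0.
  have : (n`!).+1 * (r ^ n * (r - n * n)) <= n`! * r ^ n * r.
    apply: leq_trans (_ : n`! * ((n`!).+1 * 'C(r, n)) * r <= _).
      rewrite (leq_trans (leq_mul (leqnn _) lb)) // -ffE; apply: eq_leq; ring.
    by rewrite leq_mul2r leq_mul2l le_P !orbT.
  rewrite mulnCA [n`! * _]mulnC -mulnA leq_pmul2l //.
  move: rn; move: (n`!) (n * n) => a b rn; rewrite mulnBr.
  by clear -rn; nia.
split=> [->|[le_f lt_f]].
  by split=> //; rewrite mulnC ffE.
have lt1 := leq_ltn_trans le_f main.
have lt2 : n`! * 'C(r, n) < f.+1 * 'C(r, n).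
  by apply: leq_ltn_trans lt_f; rewrite mulnC ffE.
move: lt1 lt2; rewrite !ltn_pmul2r // !ltnS => lt1 lt2.
by apply/eqP; rewrite eqn_leq lt1.
Qed.

Lemma dfun_fact f : dfun f -> dfun (fun v => (f v)`!).
Proof.
apply: (dfun_comp1 (F := factorial)).
apply: dioph_iff (fun v => fact_quotP (v 1) (v 0)) _; rewrite /fact_base.
have db : dfun (fun v => (v 1).+2 ^ (v 1).+3) by apply: (dfun_expS (f := fun v => (v 1).+1));
  dio.
have dbn : dfun (fun v => ((v 1).+2 ^ (v 1).+3) ^ v 1).
  apply: dioph_iff (_ : forall v, _ <-> v 0 = (v 2).+2 ^ ((v 2).+3 * v 2)) _.
    by move=> v; rewrite /shift -expnM.
  by apply: dioph_eq; [dio|apply: (dfun_expS (f := fun v => (v 2).+1)); dio].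
have dC : dfun (fun v => 'C((v 1).+2 ^ (v 1).+3, v 1)) by apply: dfun_bin; dio.
dio.
Qed.

(** * Bounded universal quantification *)

(* For [i] small compared to [L], these moduli are pairwise coprime, the product of the
   first [y] of them is ['C(L`!.-1, y)], and [L`!.-1] is congruent to [i] modulo the
   [i]-th one. *)
Definition crt_mod L i := (L`! %/ i.+1).-1.

Section CrtMod.
Variables (N L : nat).
Hypotheses (N3 : 2 < N) (NL : N * N <= L).

Lemma crt_modE i : i < N -> (crt_mod L i * i.+1 + i.+1 = L`!).
Proof.
move=> iN; rewrite -mulSnr /crt_mod prednK.
  by rewrite divnK // dvdn_fact //; nia.
by rewrite divn_gt0 // dvdn_leq ?fact_gt0 // dvdn_fact //; nia.
Qed.

(** For [p <= N], [(i + 1) p] divides [L! = (i + 1) (m_i + 1)], so [p] divides [m_i + 1] and not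
    [m_i]. *)
Lemma crt_mod_prime i p : i < N -> prime p -> p %| crt_mod L i -> N < p.
Proof.
move=> iN p_pr; rewrite ltnNge; apply: contraL => pN.
have p0 := prime_gt0 p_pr.
have : i.+1 * p %| L`! by rewrite dvdn_fact // muln_gt0 p0 /=; nia.
rewrite -(crt_modE iN) -mulSnr mulnC dvdn_pmul2r // => H.
by apply/negP => pm; move: H; rewrite -addn1 dvdn_addr // Euclid_dvd1.
Qed.

Lemma crt_mod_gt1 i : i < N -> 1 < crt_mod L i.
Proof.
move=> iN; have d : i.+1 * 3 %| L`! by rewrite dvdn_fact //; nia.
have := dvdn_leq (fact_gt0 L) d.
by have := crt_modE iN; move: (crt_mod L i) (L`!) => a b; nia.
Qed.

(** A common prime factor divides [(i + 1) m_i - (j + 1) m_j = j - i], but it exceeds [N]. *)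
Lemma crt_mod_coprime i j : i < N -> j < N -> i != j -> coprime (crt_mod L i) (crt_mod L j).
Proof.
move=> iN jN; apply: contraR => cop.
wlog le_ij : i j iN jN cop / i <= j => [H|].
  have [/H|/ltnW/H] := leqP i j; first exact.
  by rewrite eq_sym coprime_sym; apply.
have [p p_pr] : exists2 p, prime p & p %| gcdn (crt_mod L i) (crt_mod L j).
  exists (pdiv (gcdn (crt_mod L i) (crt_mod L j))); last exact: pdiv_dvd.
  apply: pdiv_prime; rewrite ltn_neqAle eq_sym cop gcdn_gt0 /=.
  by rewrite ltnW ?crt_mod_gt1.
rewrite dvdn_gcd => /andP[pi pj]; have Np := crt_mod_prime iN p_pr pi.
have : p %| j - i.
  have := crt_modE iN; rewrite -(crt_modE jN) => E.
  have {E} : crt_mod L i * i.+1 = crt_mod L j * j.+1 + (j - i) by lia.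
  by move=> E; rewrite -(dvdn_addr _ (dvdn_mulr j.+1 pj)) -E dvdn_mulr.
case: (posnP (j - i)) => [|ji0 /(dvdn_leq ji0)]; last by lia.
by move=> ? _; apply/eqP; lia.
Qed.

(** With [T = L! - 1], each factor [(T - i) / (i + 1)] of the binomial coefficient equals [m_i]. *)
Lemma bin_crt y : y <= N -> 'C(L`!.-1, y) = \prod_(i < y) crt_mod L i.
Proof.
elim: y => [|y IH] yN; first by rewrite bin0 big_ord0.
apply/eqP; rewrite -(@eqn_pmul2l y.+1) // mul_bin_left IH ?(ltnW yN) // big_ord_recr /=.
have -> : L`!.-1 - y = crt_mod L y * y.+1 by have := crt_modE yN; lia.
by apply/eqP; ring.
Qed.

Lemma crt_eqmod y a b : y <= N -> (forall i, i < y -> a = b %[mod crt_mod L i]) ->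
  a = b %[mod 'C(L`!.-1, y)].
Proof.
move=> yN; rewrite bin_crt //; elim: y yN => [|y IH] yN H.
  by rewrite big_ord0 !modn1.
rewrite big_ord_recr /=; apply/eqP; rewrite chinese_remainder.
  by rewrite (IH (ltnW yN)) ?H ?eqxx // => i iy; apply: H; apply: ltnW.
rewrite coprime_sym; elim/big_ind: _ => [|m n|[i iy] _]; rewrite ?coprimen1 //.
  by rewrite coprimeMr => -> ->.
by apply: crt_mod_coprime => //=; lia.
Qed.

Lemma crt_exists y (f : nat -> nat) : y <= N ->
  exists c, forall i, i < y -> c = f i %[mod crt_mod L i].
Proof.
elim: y => [|y IH] yN; first by exists 0.
have [c cP] := IH (ltnW yN).
have cop : coprime 'C(L`!.-1, y) (crt_mod L y).
  rewrite bin_crt ?(ltnW yN) // coprime_sym.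
  elim/big_ind: _ => [|m n|[i iy] _]; rewrite ?coprimen1 //.
    by rewrite coprimeMr => -> ->.
  by apply: crt_mod_coprime => //=; lia.
exists (chinese 'C(L`!.-1, y) (crt_mod L y) c (f y)) => i.
rewrite ltnS leq_eqVlt => /predU1P[->|iy]; first exact: chinese_modr.
rewrite -cP //.
have d : crt_mod L i %| 'C(L`!.-1, y).
  rewrite bin_crt ?(ltnW yN) // (bigD1 (Ordinal iy)) //=; exact: dvdn_mulr.
by rewrite -(modn_dvdm _ d) chinese_modl // modn_dvdm.
Qed.

End CrtMod.

(** * Systems modulo a number *)

Definition atom_vars T (A : atom T) : seq T :=
  match A with
  | AOne i => [:: i]
  | AAdd i j k | AMul i j k => [:: i; j; k]
  end.

Definition atom_mod T (M : nat) (v : T -> nat) (A : atom T) : Prop :=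
  match A with
  | AOne i => v i = 1 %[mod M]
  | AAdd i j k => v i = v j + v k %[mod M]
  | AMul i j k => v i = v j * v k %[mod M]
  end.

(** Both sides of an atom with entries at most [u] are below [p], so congruent sides are equal. *)
Lemma atom_sat_mod (T : eqType) p u (v w : T -> nat) (A : atom T) :
  u * u + u + u + 1 < p -> (forall x, x \in atom_vars A -> w x = v x %[mod p]) ->
  (forall x, x \in atom_vars A -> v x <= u) -> atom_mod p w A -> atom_sat v A.
Proof.
have E a b : a < p -> b < p -> a = b %[mod p] -> a == b by move=> ap bp;
  rewrite !modn_small // => ->.
move=> up; case: A => [x|x y z|x y z] /= wv vu H.
- by apply: E; rewrite -?wv ?inE ?eqxx //; have := vu x; rewrite inE eqxx; lia.
- have [vx vy vz] : [/\ v x <= u, v y <= u & v z <= u] by split; apply: vu;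
  rewrite !inE eqxx ?orbT.
  apply: E; [lia|lia|].
  by rewrite -wv ?inE ?eqxx // H -modnDm !wv ?inE ?eqxx ?orbT // modnDm.
- have [vx vy vz] : [/\ v x <= u, v y <= u & v z <= u] by split; apply: vu;
  rewrite !inE eqxx ?orbT.
  apply: E; [lia|nia|].
  by rewrite -wv ?inE ?eqxx // H -modnMm !wv ?inE ?eqxx ?orbT // modnMm.
Qed.

Lemma atom_mod_sat (T : eqType) p (v w : T -> nat) (A : atom T) :
  (forall x, x \in atom_vars A -> w x = v x %[mod p]) -> atom_sat v A -> atom_mod p w A.
Proof.
case: A => [x|x y z|x y z] /= wv /eqP H.
- by rewrite wv ?inE ?eqxx // H.
- by rewrite wv ?inE ?eqxx // H -modnDm -!wv ?inE ?eqxx ?orbT // modnDm.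
- by rewrite wv ?inE ?eqxx // H -modnMm -!wv ?inE ?eqxx ?orbT // modnMm.
Qed.

Lemma atom_mod_dvd T M p (v : T -> nat) A : p %| M -> atom_mod M v A -> atom_mod p v A.
Proof.
move=> pM; have E a b : a = b %[mod M] -> a = b %[mod p].
  by move=> ab; rewrite -(modn_dvdm a pM) ab modn_dvdm.
by case: A => [x|x y z|x y z] /=; apply: E.
Qed.

Lemma atom_mod_crt T N L y (v : T -> nat) A : 2 < N -> N * N <= L -> y <= N ->
  (forall i, i < y -> atom_mod (crt_mod L i) v A) -> atom_mod 'C(L`!.-1, y) v A.
Proof.
by move=> N2 NL yN; case: A => [a|a b c|a b c] /= H; apply: (crt_eqmod N2 NL yN).
Qed.

Lemma dioph_atom_mod T M (f : T -> env -> nat) A : dfun M -> (forall i, dfun (f i)) ->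
  dioph (fun v => atom_mod (M v) (f ^~ v) A).
Proof.
by move=> dM df; case: A => [a|a b c|a b c] /=; apply: dioph_eqmod => //;
  [apply: dfun_const|apply: dfunD|apply: dfunM].
Qed.

(* The quantified variable, of index 0, is represented by [T = L`!.-1], which is
   congruent to [i] modulo [crt_mod L i]. *)
Definition forall_val (T : nat) (v w : env) (x : nat + nat) : nat :=
  match x with inl 0 => T | inl j.+1 => v j | inr j => w j end.

Definition scons (i : nat) (v : env) : env := fun j => if j is k.+1 then v k else i.

Definition var_idx (x : nat + nat) : nat := match x with inl j | inr j => j end.

Definition sys_bound (s : seq (atom (nat + nat))) : nat :=
  \max_(A <- s) \max_(x <- atom_vars A) (var_idx x).+1.

Lemma sys_boundP s x A k : k < size s -> x \in atom_vars (nth A s k) ->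
  var_idx x < sys_bound s.
Proof.
rewrite /sys_bound; elim: s k => // B s IH [_ xA|k ks xA]; rewrite big_cons leq_max.
  by rewrite (leq_bigmax_seq (F := fun x => (var_idx x).+1)).
by rewrite (IH k ks) ?orbT.
Qed.

Lemma crt_mod_coprime_fact N L i n : 2 < N -> N * N <= L -> i < N -> n <= N ->
  coprime (crt_mod L i) n`!.
Proof.
move=> N2 NL iN nN; elim: n nN => [|n IH] nN; first by rewrite coprimen1.
rewrite factS coprimeMr (IH (ltnW nN)) andbT.
apply/negPn/negP => cop.
pose p := pdiv (gcdn (crt_mod L i) n.+1).
have p_pr : prime p by apply: pdiv_prime; rewrite ltn_neqAle eq_sym cop gcdn_gt0 orbT.
have : p %| gcdn (crt_mod L i) n.+1 by apply: pdiv_dvd.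
rewrite dvdn_gcd => /andP[/(crt_mod_prime N2 NL iN p_pr) Np /(dvdn_leq (ltn0Sn n))]; lia.
Qed.

Lemma forall_crtP s y v : let N := sys_bound s in let A0 := AOne (inl 0) in
  (forall i, i < y -> exists w, sys_sat (env_sum (scons i v) w) s) <->
  exists u T w, T.+1 = (u.+3 ^ 6)`! /\ y <= u /\ (forall j, j < N -> v j <= u) /\
    (forall j, j < N -> 'C(T, y) %| 'C(w j, u.+1)) /\
    (forall k, k < size s -> atom_mod 'C(T, y) (forall_val T v w) (nth A0 s k)).
Proof.
move=> N A0; split.
  move=> H; have [w wP] : exists w : nat -> env, forall i,
    i < y -> sys_sat (env_sum (scons i v) (w i)) s.
    have /choice[w wP] : forall i, exists w, i < y -> sys_sat (env_sum (scons i v) w) s.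
      by move=> i; have [/H[w ws]|_] := ltnP i y; [exists w|exists v].
    by exists w.
  pose u := y + \max_(j < N) v j + \max_(i < y) \max_(j < N) w i j.
  have vu j : j < N -> v j <= u.
    move=> jN; apply: (leq_trans (leq_bigmax (Ordinal jN) (F := fun j : 'I_N => v j))).
    by rewrite /u addnAC leq_addl.
  have wu i j : i < y -> j < N -> w i j <= u.
    move=> iy jN; apply: (leq_trans (leq_bigmax (Ordinal jN) (F := fun j : 'I_N => w i j))).
    apply: (leq_trans (leq_bigmax (Ordinal iy) (F := fun i : 'I_y => \max_(j < N) w i j))).
    exact: leq_addl.
  have yu : y <= u by rewrite /u -addnA leq_addr.
  (* [M] plays the role of [N] in the lemmas on [crt_mod]: [M ^ 2 = L], and [M] exceeds [y] and the
     bound required by [atom_sat_mod]. *)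
  set L := u.+3 ^ 6; pose M := u.+3 ^ 3.
  have N3 : 2 < M by rewrite (@leq_trans (3 ^ 3)) // leq_exp2r.
  have NL : M * M <= L by rewrite -expnD.
  have uN : M >= u * u + u + u + 2 by rewrite /M !expnS expn0 muln1; nia.
  have yM : y <= M by clear -yu uN; nia.
  (* The witnesses for all [i < y] are merged into one number per variable. *)
  have /choice[W WP] : forall j, exists c, forall i, i < y -> c = w i j %[mod crt_mod L i].
    by move=> j; have [c cP] := crt_exists N3 NL (fun i => w i j) yM; exists c.
  exists u, L`!.-1, W; do !split=> //.
  - by rewrite prednK // fact_gt0.
  - move=> j jN; rewrite /dvdn -(mod0n 'C(L`!.-1, y)); apply/eqP.
    apply: (crt_eqmod N3 NL) => // i iy; apply/eqP; rewrite mod0n -/(dvdn _ _).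
    have iM : i < M by apply: leq_trans iy yM.
    have cop := crt_mod_coprime_fact N3 NL iM (_ : u.+1 <= M).
    have {}cop := cop ltac:(clear -uN; nia).
    (* As the modulus is prime to [(u + 1)!], it suffices that it divides the falling factorial of
       [W j]. Its factor [W j - w i j] is a multiple of the modulus; if the subtraction truncates,
       that factor is zero. *)
    rewrite -(Gauss_dvdl _ cop) bin_ffact ffact_prod.
    have wj : w i j < u.+1 by rewrite ltnS wu.
    have [le_Ww|/ltnW lt_wW] := leqP (W j) (w i j).
      by rewrite (bigD1 (Ordinal wj)) //= (eqP le_Ww) mul0n dvdn0.
    rewrite (bigD1 (Ordinal wj)) //= dvdn_mulr // -eqn_mod_dvd //.
    exact/eqP/WP.
  - move=> k ks; apply: (atom_mod_crt N3 NL yM) => i iy.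
    have iM : i < M by apply: leq_trans iy yM.
    apply: (@atom_mod_sat _ _ (env_sum (scons i v) (w i)));
      last by apply: (all_nthP A0 (wP i iy)).
    case=> [[|j]|j] //= _; last exact: WP.
    have := crt_modE N3 NL iM; rewrite -[L`!]prednK ?fact_gt0 // => /eqP;
      rewrite addnS eqSS => /eqP <-.
    by apply/eqP; rewrite eqn_mod_dvd ?leq_addl // addnK dvdn_mulr.
move=> [u [T [W [TL [yu [vu [WC sat]]]]]]] i iy.
set L := u.+3 ^ 6 in TL.
have N3 : 2 < u.+3 ^ 3 by rewrite (@leq_trans (3 ^ 3)) // leq_exp2r.
have NL : u.+3 ^ 3 * u.+3 ^ 3 <= L by rewrite -expnD.
have uN : u.+3 ^ 3 >= u * u + u + u + 2.
  by rewrite !expnS expn0 muln1; nia.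
have iN : i < u.+3 ^ 3 by nia.
have TE : T = L`!.-1 by rewrite -TL.
have [p p_pr pi] : exists2 p, prime p & p %| crt_mod L i.
  by exists (pdiv (crt_mod L i)); rewrite ?pdiv_prime ?pdiv_dvd // (crt_mod_gt1 N3 NL).
have Np := crt_mod_prime N3 NL iN p_pr pi.
have pC : p %| 'C(T, y).
  rewrite TE (bin_crt N3 NL); last by nia.
  by rewrite (bigD1 (Ordinal iy)) //= dvdn_mulr.
have Wu j : j < N -> W j %% p <= u.
  move=> /WC/(dvdn_trans pC)/(@dvdn_mulr _ _ (u.+1)`!).
  (* The prime [p] divides [W j - k] for some [k <= u], so the residue of [W j] is at most [u]; a
     truncated difference means that [W j] itself is at most [k]. *)
  rewrite bin_ffact ffact_prod Euclid_dvd_prod // big_has => /hasP[[k ku] _ /= pk].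
  have [Wk|kW] := leqP (W j) k; first by apply: leq_trans (leq_mod _ _) _; lia.
  have : W j = k %[mod p] by apply/eqP; rewrite eqn_mod_dvd // ltnW.
  by move=> ->; rewrite modn_small; lia.
exists (fun j => W j %% p); apply/(all_nthP A0) => k ks.
apply: (@atom_sat_mod _ p u _ (forall_val T v W)).
- by lia.
- case=> [[|j]|j] //= _; last by rewrite modn_mod.
  have := crt_modE N3 NL iN; rewrite -TL => /eqP; rewrite addnS eqSS => /eqP <-.
  by apply/eqP; rewrite eqn_mod_dvd ?leq_addl // addnK dvdn_mulr.
- case=> [[|j]|j] /(sys_boundP ks) jN //=; first by lia.
    by apply: vu; apply: ltnW.
  exact: Wu.
exact: atom_mod_dvd pC (sat k ks).
Qed.

Lemma dioph_exs2 (Q : env -> env -> Prop) :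
  dioph (fun v => Q (fun i => v i.*2) (fun i => v i.*2.+1)) -> dioph (fun v => exists w, Q w v).
Proof.
move=> /dioph_exs; apply: dioph_iff => v.
have E w : (fun i => mix w v i.*2) = w /\ (fun i => mix w v i.*2.+1) = v.
  by split; apply: funext => i; rewrite /mix /= odd_double ?uphalf_double ?doubleK.
by split=> -[w p]; exists w; have [E1 E2] := E w; move: p; rewrite E1 E2.
Qed.

Lemma dioph_forall (P : nat -> env -> Prop) b :
  dioph (fun v => P (v 0) (fun i => v i.+1)) -> dfun b ->
  dioph (fun v => forall i, i < b v -> P i v).
Proof.
move=> [s sP] db.
have : dioph (fun v => forall i, i < v 0 -> P i (fun i => v i.+1)); last first.
  by move=> dP; apply: (dioph_sub1 (R := fun x v => forall i, i < x -> P i v)).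
have {sP} sP i v : P i v <-> exists w, sys_sat (env_sum (scons i v) w) s
  by apply: (sP (scons i v)).
apply: dioph_iff (_ : forall v, _ <-> forall i, i < v 0 -> exists w,
  sys_sat (env_sum (scons i (fun i => v i.+1)) w) s) _.
  by move=> v; split=> H i /H /sP.
apply: dioph_iff (fun v => forall_crtP s (v 0) (fun i => v i.+1)) _.
apply: dioph_ex; apply: dioph_ex.
apply: (dioph_exs2 (Q := fun w v => (v 0).+1 = ((v 1).+3 ^ 6)`! /\ v 2 <= v 1 /\
  (forall j, j < sys_bound s -> v j.+3 <= v 1) /\
  (forall j, j < sys_bound s -> 'C(v 0, v 2) %| 'C(w j, (v 1).+1)) /\
  (forall k, k < size s -> atom_mod 'C(v 0, v 2)
    (forall_val (v 0) (fun j => v j.+3) w) (nth (AOne (inl 0)) s k)))).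
have dM i j : dfun (fun v : env => 'C(v i, v j)) by apply: dfun_bin; dio.
do ![apply: dioph_and].
- apply: dioph_eq; first by dio.
  by apply: dfun_fact; apply: (dfun_expS (f := fun v => (v _).+2)); dio.
- by dio.
- by apply: dioph_conj => j _; dio.
- apply: dioph_conj => j _; apply: dioph_dvd => //.
  by apply: dfun_bin; dio.
- apply: dioph_conj => k _; apply: (dioph_atom_mod (f := fun x v =>
    forall_val (v 0.*2.+1) (fun j => v j.+3.*2.+1) (fun j => v j.*2) x)) => //.
  by case=> [[|j]|j]; apply: dfun_var.
Qed.

(** * Recursive functions *)

(* Goedel's beta function for the moduli [crt_mod]. *)
Definition seqval c L i r := exists m, m.+1 = L`! %/ i.+1 /\ r.+1 <= m /\ c = r %[mod m].

Lemma seqval_inj c L i r r' : seqval c L i r -> seqval c L i r' -> r = r'.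
Proof.
move=> [m [mE [rm cr]]] [m' [m'E [rm' cr']]].
have E : m' = m by apply: succn_inj; rewrite mE m'E.
by rewrite E in rm' cr'; move: cr; rewrite cr' !modn_small.
Qed.

Lemma seqval_exists (h : nat -> nat) n : exists c L, forall i, i <= n -> seqval c L i (h i).
Proof.
(* The modulus of index [i] is at least [N - 1], so [N] must exceed all values by more than one. *)
pose N := n + 3 + \max_(i < n.+1) h i.
have N3 : 2 < N by rewrite /N; lia.
have hN i : i <= n -> (h i).+2 < N.
  move=> iN; have := leq_bigmax (Ordinal (iN : i < n.+1)) (F := fun i : 'I_n.+1 => h i).
  rewrite /N /=; lia.
have nN : n.+1 <= N by rewrite /N; lia.
have [c cP] := crt_exists N3 (leqnn (N * N)) h nN.
exists c, (N * N) => i le_in.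
have iN : i < N by have := hN i le_in; rewrite /N; lia.
exists (crt_mod (N * N) i); split; last split.
- by rewrite -(crt_modE N3 (leqnn _) iN) -mulSnr mulnK.
- have d : i.+1 * N %| (N * N)`! by rewrite dvdn_fact //; nia.
  have := dvdn_leq (fact_gt0 _) d; rewrite -(crt_modE N3 (leqnn _) iN) -mulSnr mulnC
    leq_pmul2r //.
  by have := hN i le_in; lia.
exact: cP.
Qed.

Lemma dioph_seqval f g h k : dfun f -> dfun g -> dfun h -> dfun k ->
  dioph (fun v => seqval (f v) (g v) (h v) (k v)).
Proof.
apply: (dioph_rel4 (R := seqval)); rewrite /seqval.
have d : dfun (fun v => (v 2)`! %/ (v 3).+1).
  by apply: dfun_divn => //; [apply: dfun_fact|]; dio.
by dio.
Qed.

(** Only the values of [h] up to [b v] matter. Two numbers [c], [L] code them, and the condition on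
    [S] becomes a bounded quantifier. *)
Lemma dioph_rec (R : nat -> env -> Prop) (S : nat -> nat -> nat -> env -> Prop) b y :
  dioph (fun v => R (v 0) (fun i => v i.+1)) ->
  dioph (fun v => S (v 0) (v 1) (v 2) (fun i => v i.+3)) ->
  dfun b -> dfun y ->
  dioph (fun v => exists h : nat -> nat,
    [/\ R (h 0) v, forall m, m < b v -> S m (h m) (h m.+1) v & y v = h (b v)]).
Proof.
move=> dR dS db dy.
have : dioph (fun v => exists c L r, seqval c L 0 r /\ R r v /\
  (forall m, m < b v -> exists p q, seqval c L m p /\ seqval c L m.+1 q /\ S m p q v) /\
  seqval c L (b v) (y v)); last first.
  apply: dioph_iff => v; split=> [[h [R0 Sh yE]]|[c [L [r [sr [R0 [SS sy]]]]]]].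
    have [c [L cP]] := seqval_exists h (b v).
    exists c, L, (h 0); do !split=> //; first exact: cP.
      move=> m mb; exists (h m), (h m.+1); do !split; [exact/cP/ltnW|exact: cP|exact: Sh].
    by rewrite yE; apply: cP.
  have /choice[h hP] : forall i, exists x, i <= b v -> seqval c L i x.
    move=> i; have [ib|_] := leqP i (b v); last by exists 0.
    move: ib; rewrite leq_eqVlt => /predU1P[->|/SS[p [_ [sp _]]]];
      [by exists (y v)|by exists p].
  exists h; split; last by apply: seqval_inj sy _; apply: hP.
    by rewrite (seqval_inj (hP 0 (leq0n _)) sr).
  move=> m mb; have [p [q [sp [sq]]]] := SS m mb.
  by rewrite (seqval_inj sp (hP m (ltnW mb))) (seqval_inj sq (hP m.+1 mb)).
do 3 apply: dioph_ex.
apply: dioph_and; first by apply: dioph_seqval; dio.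
apply: dioph_and.
  exact: (dioph_ren (fun i => if i is j.+1 then j.+3 else 0) dR).
apply: dioph_and; last first.
  by apply: dioph_seqval; try dio; [exact: (dfun_ren (fun i =>
    i.+3) db)|exact: (dfun_ren (fun i => i.+3) dy)].
apply: dioph_forall; last exact: (dfun_ren (fun i => i.+3) db).
apply: dioph_ex; apply: dioph_ex.
apply: dioph_and; first by apply: dioph_seqval; dio.
apply: dioph_and; first by apply: dioph_seqval; dio.
exact: (dioph_ren (fun i => match i with 0 => 2 | 1 => 1 | 2 => 0 | j.+3 => j.+3.+3 end) dS).
Qed.

(** Since [R] depends only on the first [n] variables, finitely many equations describe the
    substitution. *)
Lemma dioph_subst n (R : env -> Prop) (F : nat -> env -> nat) :
  (forall w w', (forall i, i < n -> w i = w' i) -> R w -> R w') ->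
  dioph R -> (forall i, i < n -> dfun (F i)) -> dioph (fun v => R (F ^~ v)).
Proof.
move=> Rn dR dF.
have : dioph (fun v => exists w, (forall i, i < n -> w i = F i v) /\ R w).
  apply: (dioph_exs2 (Q := fun w v => (forall i, i < n -> w i = F i v) /\ R w)).
  apply: dioph_and; last exact: (dioph_ren double dR).
  apply: dioph_conj => i iN; apply: dioph_eq; first exact: dfun_var.
  exact: (dfun_ren (fun i => i.*2.+1) (dF i iN)).
apply: dioph_iff => v; split=> [H|[w [wE]]]; last exact: Rn.
by exists (F ^~ v).
Qed.

Definition tuple_of_env n (v : env) : n.-tuple nat := [tuple v i | i < n].

Lemma tuple_of_env_ext n v w : (forall i, i < n -> v i = w i) ->
  tuple_of_env n v = tuple_of_env n w.
Proof. by move=> vw; apply: eq_from_tnth => i; rewrite !tnth_mktuple vw. Qed.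

Lemma cons_tuple_of_env n x v : [tuple of x :: tuple_of_env n v] = tuple_of_env n.+1 (scons x
  v).
Proof.
apply: eq_from_tnth => i; rewrite tnth_mktuple.
by case: (unliftP ord0 i) => [j|] ->; rewrite ?tnth0 // tnthS tnth_mktuple.
Qed.

Lemma behead_tuple_of_env n v : behead_tuple (tuple_of_env n.+1 v) = tuple_of_env n (shift v).
Proof. by apply: eq_from_tnth => i; rewrite tnth_behead !tnth_mktuple /= inordK // ltnS. Qed.

Lemma prec_args n m p v :
  [tuple of m :: p :: behead_tuple (tuple_of_env n.+1 v)] =
  tuple_of_env n.+2 (scons m (scons p (shift v))).
Proof.
rewrite -!cons_tuple_of_env; apply: val_inj => /=.
by have /(congr1 val) /= -> := behead_tuple_of_env n v.
Qed.

Lemma thead_tuple_of_env n v : thead (tuple_of_env n.+1 v) = v 0.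
Proof. by rewrite /thead tnth_mktuple. Qed.

Lemma tuple_of_env_surj n (x : n.-tuple nat) : exists v, x = tuple_of_env n v.
Proof.
exists (nth 0 x); apply: eq_from_tnth => i; by rewrite tnth_mktuple (tnth_nth 0).
Qed.

Lemma dioph_conj_ord n (P : 'I_n -> env -> Prop) :
  (forall i, dioph (P i)) -> dioph (fun v => forall i, P i v).
Proof.
move=> dP.
have : dioph (fun v => forall j, j < n -> forall i : 'I_n, i = j :> nat -> P i v).
  apply: dioph_conj => j jn; apply: dioph_iff (dP (Ordinal jn)) => v.
  split=> [H|H i ij]; first exact: H.
  by have -> : i = Ordinal jn by apply: val_inj.
by apply: dioph_iff => v; split=> [H j _ i _|H i] //; apply: (H i).
Qed.

Lemma dioph_computes_subst n (f : murec n) (F : nat -> env -> nat) y :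
  dioph (fun v => computes f (tuple_of_env n (shift v)) (v 0)) ->
  (forall i, i < n -> dfun (F i)) -> dfun y ->
  dioph (fun v => computes f (tuple_of_env n (F ^~ v)) (y v)).
Proof.
move=> df dF dy.
apply: (dioph_subst (n := n.+1) (R := fun v => computes f (tuple_of_env n (shift v)) (v 0))
  (F := fun i v => if i is j.+1 then F j v else y v)) => //.
  move=> w w' ww'; rewrite ww' //; congr computes.
  by apply: tuple_of_env_ext => i iN; apply: ww'.
by case.
Qed.

(** The intermediate values of a composition form a quantified environment, recursion is
    [dioph_rec], and minimisation needs [dioph_forall]. *)
Lemma dioph_computes n (f : murec n) :
  dioph (fun v => computes f (tuple_of_env n (shift v)) (v 0)).
Proof.
elim: f => {n} [n||n i|n k f IHf g IHg|n f IHf g IHg|n f IHf] /=.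
- by dio.
- by apply: dioph_iff (_ : forall v, _ <-> v 0 = (v 1).+1) _ => [v|];
  [rewrite thead_tuple_of_env|dio].
- by apply: dioph_iff (_ : forall v, _ <-> v 0 = v i.+1) _ => [v|]; [rewrite tnth_mktuple|dio].
- have : dioph (fun v => exists w, (forall i,
  computes (g i) (tuple_of_env n (shift v)) (w (val i))) /\
      computes f (tuple_of_env k w) (v 0)).
    apply: (dioph_exs2 (Q := fun w v => (forall i,
      computes (g i) (tuple_of_env n (shift v)) (w (val i))) /\
      computes f (tuple_of_env k w) (v 0))).
    apply: dioph_and; last first.
      by apply: (dioph_computes_subst (F := fun i v => v i.*2)) => // *; dio.
    apply: dioph_conj_ord => i.
    by apply: (dioph_computes_subst (F := fun i v => v i.+1.*2.+1)) => // *; dio.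
  apply: dioph_iff => v; split=> [[z [gz fz]]|[w [gw fw]]].
    have [w zE] := tuple_of_env_surj z; exists w; split; last by rewrite -zE.
    by move=> i; have := gz i; rewrite zE tnth_mktuple.
  exists (tuple_of_env k w); split=> // i; rewrite tnth_mktuple; exact: gw.
- have := @dioph_rec
    (fun z v => computes f (tuple_of_env n (shift (shift v))) z)
    (fun m p q v => computes g (tuple_of_env n.+2 (scons m (scons p (shift (shift v))))) q)
    (fun v => v 1) (fun v => v 0) _ _ (dfun_var 1) (dfun_var 0).
  move=> H; apply: dioph_iff (H _ _) => [v||].
  + rewrite thead_tuple_of_env.
    split=> -[h [H0 HS Hy]]; exists h; (split=> [|m mb|] //;
      [by move: H0; rewrite behead_tuple_of_env|by have := HS m mb; congr computes;
        rewrite prec_args]).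
  + by apply: (dioph_computes_subst (F := fun i v => v i.+3)) => // *; dio.
  + apply: (dioph_computes_subst (F := fun i v => scons (v 0) (scons (v 1) (fun j =>
    v j.+2.+3)) i)) => //; last by dio.
    by case=> [|[|i]] _ /=; dio.
- apply: dioph_and.
    apply: dioph_iff (_ : forall v, _ <-> computes f (tuple_of_env n.+1 v) 0) _.
      move=> v; rewrite cons_tuple_of_env.
      by rewrite (_ : tuple_of_env _ _ = tuple_of_env n.+1 v) //;
        apply: tuple_of_env_ext => -[].
    by apply: (dioph_computes_subst (F := fun i v => v i)) => // *; dio.
  apply: dioph_forall; last by dio.
  apply: dioph_ex.
  apply: dioph_iff (_ : forall v, _ <-> computes f (tuple_of_env n.+1 (scons (v 1) (fun i =>
    v i.+3))) (v 0).+1) _.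
    by move=> v; rewrite cons_tuple_of_env.
  by apply: (dioph_computes_subst (F := fun i v => scons (v 1) (fun i => v i.+3) i)) => //;
    [by case=> [|i] _ /=; dio|dio].
Qed.

Lemma computes_inj n (f : murec n) x y y' : computes f x y -> computes f x y' -> y = y'.
Proof.
elim: f x y y' => {n} [n|| n i|n k f IHf g IHg|n f IHf g IHg|n f IHf] x y y' /=;
  try by move=> -> ->.
- move=> [z [gz fz]] [z' [gz' fz']].
  suff E : z = z' by rewrite -E in fz'; apply: IHf fz fz'.
  by apply: eq_from_tnth => i; apply: IHg (gz i) (gz' i).
- move=> [h [h0 hS ->]] [h' [h0' hS' ->]].
  have: thead x <= thead x by [].
  elim: {1 3 4}(thead x) => [_|m IHm mx]; first exact: IHf h0 h0'.
  by have := hS' m mx; rewrite -IHm ?(ltnW mx) //; apply: IHg (hS m mx).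
- move=> [fy fm] [fy' fm']; have [lt|lt|//] := ltngtP y y'.
    by have [v /(IHf _ _ _ fy)] := fm' y lt.
  by have [v /(IHf _ _ _ fy')] := fm y' lt.
Qed.

(** * Sums of four squares *)

Local Open Scope ring_scope.

Definition sum4sq (n : int) := exists a b c d : int, n = a * a + b * b + (c * c + d * d).

(** Euler's four-square identity. *)
Lemma sum4sqM m n : sum4sq m -> sum4sq n -> sum4sq (m * n).
Proof.
move=> [a [b [c [d ->]]]] [x [y [z [t ->]]]].
exists (a * x + b * y + c * z + d * t), (a * y - b * x + c * t - d * z).
exists (a * z - c * x + d * y - b * t), (a * t - d * x + b * z - c * y); ring.
Qed.

(** The residue lies in [(- m / 2, m / 2]]; the last clause fixes its sign in the extreme case. *)
Lemma balanced_residue (m x : int) : 0 < m ->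
  exists y k, [/\ x = y + k * m, 4 * (y * y) <= m * m & (4 * (y * y) = m * m -> 2 * y = m)].
Proof.
move=> m0; have := divz_eq x m; have := modz_ge0 x (lt0r_neq0 m0); have := ltz_pmod x m0.
move: (x %/ m)%Z (x %% m)%Z => q r rm r0 xE.
have [le|lt] := leP (2 * r) m.
  exists r, q; split; [lia|nia|nia].
exists (r - m), (q + 1); split; [lia|nia|nia].
Qed.

Lemma sum4sq_eq0 (a b c d : int) : a * a + b * b + (c * c + d * d) = 0 ->
  [/\ a = 0, b = 0, c = 0 & d = 0].
Proof.
have sq (z : int) : 0 <= z * z by rewrite -expr2 sqr_ge0.
have sq0 (z : int) : z * z = 0 -> z = 0 by move=> /eqP; rewrite mulf_eq0 orbb => /eqP.
move=> E; have := sq a; have := sq b; have := sq c; have := sq d.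
by split; apply: sq0; lia.
Qed.

(** Lagrange's descent: if [y_i] are the balanced residues of [x_i] modulo [m], the sum of the
    [y_i ^ 2] is [m r] with [r <= m], and dividing Euler's identity for [(m p) (m r)] by [m ^ 2]
    writes [r p] as a sum of four squares. If [r = 0] all [y_i] vanish, if [r = m] all equal
    [m / 2]; in both cases [m] divides [p], against [1 < m < p]. *)
Lemma sum4sq_descent (p m : nat) : prime p -> (0 < m < p)%N ->
  sum4sq (m%:Z * p%:Z) -> sum4sq p.
Proof.
move=> p_pr; have [k] := ubnP m; elim: k m => // k IH m mk /andP[m0 mp].
have [->|m1] := eqVneq m 1%N; first by rewrite mul1r.
have ndvd : ~ exists K : int, p%:Z = m%:Z * K.
  move=> [K E]; have mp' : (m%:Z %| p%:Z)%Z by apply/dvdzP; exists K; rewrite mulrC.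
  by have /orP[/eqP|/eqP] := (primeP p_pr).2 m mp'; lia.
move=> [x1 [x2 [x3 [x4 E]]]].
have m0' : 0 < m%:Z by lia.
have [y1 [k1 [e1 b1 h1]]] := balanced_residue x1 m0'.
have [y2 [k2 [e2 b2 h2]]] := balanced_residue x2 m0'.
have [y3 [k3 [e3 b3 h3]]] := balanced_residue x3 m0'.
have [y4 [k4 [e4 b4 h4]]] := balanced_residue x4 m0'.
pose r := p%:Z - (2 * (y1 * k1 + y2 * k2 + y3 * k3 + y4 * k4) + m%:Z * (k1 * k1 + k2 * k2 + k3
  * k3 + k4 * k4)).
have rE : m%:Z * r = y1 * y1 + y2 * y2 + (y3 * y3 + y4 * y4).
  by rewrite /r mulrBr E e1 e2 e3 e4; ring.
have r0 : 0 <= r.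
  by rewrite -(pmulr_rge0 _ m0') rE !addr_ge0 // -expr2 sqr_ge0.
have rm : r <= m%:Z by rewrite -(ler_pM2l m0') rE; clear -b1 b2 b3 b4; lia.
have [r00|rn0] := eqVneq r 0.
  exfalso; apply: ndvd.
  have [z1 z2 z3 z4] : [/\ y1 = 0, y2 = 0, y3 = 0 & y4 = 0].
    by apply: sum4sq_eq0; rewrite -rE r00 mulr0.
  by exists (k1 * k1 + k2 * k2 + k3 * k3 + k4 * k4); move/eqP: r00;
    rewrite /r z1 z2 z3 z4 !mul0r !addr0 mulr0 add0r subr_eq0 => /eqP.
have [rm'|rnm] := eqVneq r m%:Z.
  exfalso; apply: ndvd.
  have [z1 z2 z3 z4] : [/\ 2 * y1 = m%:Z, 2 * y2 = m%:Z, 2 * y3 = m%:Z & 2 * y4 = m%:Z].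
    by split; [apply: h1|apply: h2|apply: h3|apply: h4]; rewrite rm' in rE;
      clear -rE b1 b2 b3 b4; lia.
  exists (1 + (k1 + k2 + k3 + k4) + (k1 * k1 + k2 * k2 + k3 * k3 + k4 * k4)).
  have -> : p%:Z = r + (2 * y1 * k1 + 2 * y2 * k2 + 2 * y3 * k3 + 2 * y4 * k4 + m%:Z * (k1 *
    k1 + k2 * k2 + k3 * k3 + k4 * k4)) by rewrite /r; ring.
  by rewrite z1 z2 z3 z4 rm'; ring.
have := IH `|r|%N; rewrite (_ : `|r|%N%:Z = r); last by rewrite gez0_abs.
apply; [clear -rm rnm r0 mk; lia|clear -rm rnm r0 rn0 mp; lia|].
(* The four terms of Euler's identity for the [x_i] and [y_i], divided by [m]. *)
exists (r + (k1 * y1 + k2 * y2 + k3 * y3 + k4 * y4)).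
exists (k1 * y2 - k2 * y1 + k3 * y4 - k4 * y3), (k1 * y3 - k3 * y1 + k4 * y2 - k2 * y4),
  (k1 * y4 - k4 * y1 + k2 * y3 - k3 * y2).
apply: (mulfI (_ : m%:Z * m%:Z != 0)); first by rewrite mulf_neq0 // lt0r_neq0.
transitivity ((m%:Z * p%:Z) * (m%:Z * r)); first by ring.
rewrite {1}E rE e1 e2 e3 e4.
transitivity ((m%:Z * r + m%:Z * (k1 * y1 + k2 * y2 + k3 * y3 + k4 * y4)) ^+ 2 +
 m%:Z ^+ 2 * ((k1 * y2 - k2 * y1 + k3 * y4 - k4 * y3) ^+ 2 + ((k1 * y3 - k3 * y1 + k4 * y2 -
   k2 * y4) ^+ 2 + (k1 * y4 - k4 * y1 + k2 * y3 - k3 * y2) ^+ 2))); last by ring.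
rewrite rE; ring.
Qed.

Local Close Scope ring_scope.

Lemma sqr_mod_inj p x y : prime p -> (x + y < p)%N -> (x * x = y * y %[mod p])%N -> x = y.
Proof.
move=> p_pr; wlog le_yx : x y / (y <= x)%N => [H xy E|xyp /eqP].
  by have [/H->|/ltnW/H->] := leqP y x; rewrite // addnC.
rewrite eqn_mod_dvd ?leq_mul // !mulnn subn_sqr Euclid_dvdM // => /orP[] /dvdn_leq H.
  by apply/eqP; rewrite eqn_leq le_yx andbT -subn_eq0; apply: contraTT xyp;
    rewrite -lt0n => /H; lia.
by have [|/H] := posnP (x + y); lia.
Qed.

(** Pigeonhole principle: for [x, y <= (p - 1) / 2] the squares [x ^ 2] are distinct modulo [p], and
    so are the numbers [- 1 - y ^ 2]. Together these are [p + 1] residues, so two coincide. *)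
Lemma sum3sq_prime p : prime p -> odd p ->
  exists m x y : nat, (0 < m < p)%N /\ (m * p = x * x + y * y + 1)%N.
Proof.
move=> p_pr p_odd; have p0 := prime_gt0 p_pr; pose h := p./2.+1.
have pE : p = (h + h - 1)%N by rewrite /h; have := odd_double_half p; rewrite p_odd -addnn; lia.
pose f (x : 'I_h) : 'I_p := Ordinal (ltn_pmod (x * x) p0).
have gP (x : 'I_h) : (p - 1 - (x * x) %% p < p)%N by lia.
pose g (x : 'I_h) : 'I_p := Ordinal (gP x).
have xyp (x y : 'I_h) : x + y < p.
  by have := ltn_ord x; have := ltn_ord y; lia.
have f_inj : injective f.
  by move=> x y /(congr1 val) /= E; apply/val_inj/(sqr_mod_inj p_pr) => //=.
have g_inj : injective g.
  move=> x y /(congr1 val) /= E; apply/val_inj/(sqr_mod_inj p_pr).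
    exact: xyp.
  have := ltn_pmod (x * x) p0; have := ltn_pmod (y * y) p0; clear -E.
  by move: ((x * x) %% p) ((y * y) %% p) E => a b; lia.
have /set0Pn[z /setIP[/imsetP[x _ zx] /imsetP[y _ zy]]] : [set f x | x in 'I_h] :&: [set g x |
  x in 'I_h] != set0.
  apply/negP => /eqP/eqP; rewrite setI_eq0 => dis.
  have := (leq_card_setU [set f x | x in 'I_h] [set g x | x in 'I_h]).2.
  rewrite dis !card_imset // card_ord => /eqP E.
  have := max_card (mem ([set f x | x in 'I_h] :|: [set g x | x in 'I_h])).
  by rewrite E card_ord; have := prime_gt1 p_pr; lia.
have E : (x * x) %% p + (y * y) %% p + 1 = p.
  move/(congr1 val): zx; rewrite zy /= => <-.
  by have := ltn_pmod (y * y) p0; lia.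
exists ((x * x) %/ p + (y * y) %/ p + 1), x, y.
have mE : ((x * x) %/ p + (y * y) %/ p + 1) * p = x * x + y * y + 1.
  rewrite [in RHS](divn_eq (x * x) p) [in RHS](divn_eq (y * y) p).
  by rewrite !mulnDl mul1n -[in X in _ + X = _]E; ring.
split=> //; apply/andP; split; first by rewrite addn1.
rewrite -(ltn_pmul2r p0) mE.
have := ltn_ord x; have := ltn_ord y; have := prime_gt1 p_pr.
clear -pE; move: (nat_of_ord x) (nat_of_ord y) => a b; nia.
Qed.

Local Open Scope ring_scope.

Lemma sum4sq_nat (n : nat) : sum4sq n.
Proof.
have [k] := ubnP n; elim: k n => // k IH n nk.
have [n1|n2] := leqP n 1.
  by exists n%:Z, 0, 0, 0; case: n n1 nk => [|[|]].
have [p_pr|np] := boolP (prime n).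
  have [->|n_odd] := eqVneq n 2%N; first by exists 1, 1, 0, 0.
  have [m [x [y [mp E]]]] := sum3sq_prime p_pr (ltac:(by case/even_prime: p_pr n_odd => // ->)).
  apply: sum4sq_descent p_pr mp _; exists x%:Z, y%:Z, 1, 0; lia.
have pd := pdiv_dvd n; have p1 := pdiv_prime n2.
rewrite -(divnK pd) PoszM; apply: sum4sqM; apply: IH.
  rewrite (leq_trans (_ : n %/ pdiv n < n)%N) // ltn_Pdiv ?prime_gt1 //; lia.
apply: leq_trans (_ : pdiv n < n)%N _ => //.
rewrite ltn_neqAle dvdn_leq ?andbT //; last by lia.
by apply: contra np => /eqP <-.
Qed.

Local Close Scope ring_scope.

(** * From natural numbers to integers *)

Definition atom_satz T (z : T -> int) (A : atom T) : bool :=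
  match A with
  | AOne i => (z i == 1)%R
  | AAdd i j k => (z i == z j + z k)%R
  | AMul i j k => (z i == z j * z k)%R
  end.

Lemma atom_satz_nat T (v : T -> nat) (z : T -> int) A : (forall i, (v i)%:Z%R = z i) ->
  atom_satz z A = atom_sat v A.
Proof. by move=> vz; case: A => [i|i j k|i j k] /=; rewrite -!vz -?PoszD -?PoszM eqz_nat. Qed.

Lemma dioph_finite (R : nat -> Prop) : dioph (fun v => R (v 0)) ->
  exists N (s : seq (atom 'I_N.+1)), forall n,
    R n <-> exists v, v ord0 = n /\ sys_sat v s.
Proof.
move=> [s sP]; pose N := (sys_bound s).*2.
pose f (x : nat + nat) : 'I_N.+1 := inord (match x with inl j => j.*2 | inr j => j.*2.+1 end).
exists N, (map (atom_map f) s) => n; split=> [Rn|[v [<- vs]]].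
  have [w ws] := (sP (fun=> n)).1 Rn.
  (* Even indices hold the free variables of the system. Only variable 0 matters for [R], so all of
     them may take the value [n]. *)
  exists (fun i : 'I_N.+1 => if odd i then w i./2 else n); split=> //.
  rewrite sys_sat_map; apply/(all_nthP (AOne (inl 0))) => k ks.
  have := (all_nthP (AOne (inl 0)) ws) k ks;
    have := fun x => @sys_boundP s x (AOne (inl 0)) k ks.
  have E x : var_idx x < sys_bound s -> (fun i : 'I_N.+1 =>
    if odd i then w i./2 else n) (f x) = env_sum (fun=> n) w x.
    by case: x => j /= jN; rewrite /f inordK /= ?odd_double ?uphalf_double // /N; lia.
  by case: (nth _ s k) => [i|i j l|i j l] /= H; rewrite !E // H // !inE ?eqxx ?orbT.
pose u : env := fun j => v (inord j.*2).
suff : R (u 0) by rewrite /u (_ : inord _ = ord0) //; apply: val_inj; rewrite /= inordK.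
apply/sP; exists (fun j => v (inord j.*2.+1)).
by move: vs; rewrite sys_sat_map; congr is_true; apply: sys_sat_ext => -[].
Qed.

Lemma all_flatten T (p : pred T) ss : all p (flatten ss) = all (all p) ss.
Proof. by elim: ss => //= s ss IH; rewrite all_cat IH. Qed.

Section FourSquares.
Variables (T : finType).

(** Index 0 is the variable itself, 1 to 4 are the roots, 5 to 8 their squares, 9 and 10 the partial
    sums. *)
Definition four_squares_atoms (i : T) : seq (atom (T * 'I_11)) :=
  let x k : T * 'I_11 := (i, inord k) in
  [:: AMul (x 5) (x 1) (x 1); AMul (x 6) (x 2) (x 2); AMul (x 7) (x 3) (x 3);
      AMul (x 8) (x 4) (x 4); AAdd (x 9) (x 5) (x 6); AAdd (x 10) (x 7) (x 8);
      AAdd (x 0) (x 9) (x 10)].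

Definition four_squares_sys (s : seq (atom T)) : seq (atom (T * 'I_11)) :=
  map (atom_map (fun i => (i, ord0))) s ++ flatten (map four_squares_atoms (enum T)).

Lemma four_squares_nat s v : sys_sat v s ->
  exists w, (forall i, w (i, ord0) = v i) /\ sys_sat w (four_squares_sys s).
Proof.
move=> vs.
have /choice[r rP] : forall i, exists r : nat -> nat,
    v i = r 1 * r 1 + r 2 * r 2 + (r 3 * r 3 + r 4 * r 4).
  move=> i; have [a [b [c [d E]]]] := sum4sq_nat (v i).
  exists (fun k => nth 0 [:: 0; `|a|; `|b|; `|c|; `|d|]%N k) => /=; lia.
pose w (x : T * 'I_11) := nth 0 [:: v x.1; r x.1 1; r x.1 2; r x.1 3; r x.1 4;
  r x.1 1 * r x.1 1; r x.1 2 * r x.1 2; r x.1 3 * r x.1 3; r x.1 4 * r x.1 4;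
  r x.1 1 * r x.1 1 + r x.1 2 * r x.1 2; r x.1 3 * r x.1 3 + r x.1 4 * r x.1 4] x.2.
exists w; split=> //; rewrite /sys_sat all_cat; apply/andP; split.
  by rewrite -/(sys_sat _ _) sys_sat_map.
rewrite all_flatten all_map; apply/allP => i _ /=.
by rewrite /w /= !inordK //= !eqxx -rP eqxx.
Qed.

Lemma four_squares_int s z : all (atom_satz z) (four_squares_sys s) ->
  exists v, (forall i, (v i)%:Z%R = z (i, ord0)) /\ sys_sat v s.
Proof.
rewrite all_cat => /andP[zs]; rewrite all_flatten all_map => /allP z4.
have z0 i : (0 <= z (i, ord0))%R.
  have /= := z4 i (mem_enum _ _).
  have -> : inord 0 = ord0 :> 'I_11 by apply: val_inj; rewrite /= inordK.
  move=> /and5P[/eqP E1 /eqP E2 /eqP E3 /eqP E4 /and4P[/eqP E5 /eqP E6 /eqP E7 _]].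
  by rewrite E7 E5 E6 E1 E2 E3 E4 !Num.Theory.addr_ge0 // -expr2 Num.Theory.sqr_ge0.
exists (fun i => `|z (i, ord0)|%N); split=> [i|]; first by have := z0 i; lia.
rewrite all_map in zs; apply: sub_all zs => A /=.
rewrite -(@atom_satz_nat _ _ (fun i => z (i, ord0))) => [|i]; last by have := z0 i; lia.
by case: A.
Qed.

End FourSquares.

(** * Reduction to equations with abelianisation constraints *)

Definition heis : Type := (int * int * int)%type.
HB.instance Definition _ := Choice.on heis.

Section Heisenberg.
Local Open Scope ring_scope.

(** The triple [(a, b, c)] is the unitriangular 3 by 3 matrix with [a], [b] above the diagonal and
    [c] in the corner. *)
Definition heis_mul (g h : heis) : heis :=
  (g.1.1 + h.1.1, g.1.2 + h.1.2, g.2 + h.2 + g.1.1 * h.1.2).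
Definition heis_one : heis := (0, 0, 0).
Definition heis_inv (g : heis) : heis := (- g.1.1, - g.1.2, g.1.1 * g.1.2 - g.2).

Lemma heis_eq (g h : heis) : g.1.1 = h.1.1 -> g.1.2 = h.1.2 -> g.2 = h.2 -> g = h.
Proof. by case: g h => [[a b] c] [[a' b'] c'] /= -> -> ->. Qed.

Lemma heis_mulA : associative heis_mul.
Proof. by move=> g h k; apply: heis_eq; rewrite /heis_mul /=; ring. Qed.

Lemma heis_mul1 : left_id heis_one heis_mul.
Proof. by move=> g; apply: heis_eq; rewrite /heis_mul /=; ring. Qed.

Lemma heis_mulr1 : right_id heis_one heis_mul.
Proof. by move=> g; apply: heis_eq; rewrite /heis_mul /=; ring. Qed.

Lemma heis_mulV : left_inverse heis_one heis_inv heis_mul.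
Proof. by move=> g; apply: heis_eq; rewrite /heis_mul /=; ring. Qed.

Lemma heis_mulrV : right_inverse heis_one heis_inv heis_mul.
Proof. by move=> g; apply: heis_eq; rewrite /heis_mul /=; ring. Qed.

End Heisenberg.

HB.instance Definition _ :=
  isGroup.Build heis heis_mulA heis_mul1 heis_mulr1 heis_mulV heis_mulrV.

Local Open Scope group_scope.

Lemma heis_commute (g h : heis) : commute g h -> (g.1.1 * h.1.2 = h.1.1 * g.1.2)%R.
Proof.
move=> /(congr1 snd) /= E.
have {}E : (g.2 + h.2 + g.1.1 * h.1.2 = h.2 + g.2 + h.1.1 * g.1.2)%R by [].
by move: E; lia.
Qed.

(** * Words, and homomorphisms from a right-angled Artin group *)

Section WordEval.
Variables (S : finType) (G : groupType).
Implicit Types (f : S -> G) (u v w : word S).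

Lemma word_eval_cat f u v : word_eval f (u ++ v) = word_eval f u * word_eval f v.
Proof. exact: big_cat. Qed.

Lemma word_eval_cons f l w :
  word_eval f (l :: w) = (if l.2 then (f l.1)^-1 else f l.1) * word_eval f w.
Proof. exact: big_cons. Qed.

Lemma word_eval_seq1 f l : word_eval f [:: l] = if l.2 then (f l.1)^-1 else f l.1.
Proof. exact: big_seq1. Qed.

Lemma word_eval_inv f w : word_eval f (word_inv w) = (word_eval f w)^-1.
Proof.
elim: w => [|l w IH]; first by rewrite /word_eval !big_nil invg1.
rewrite -cat1s word_inv_cat !word_eval_cat invgM IH !word_eval_seq1.
by case: l => s [] /=; rewrite ?invgK.
Qed.

Lemma word_eval_nseq f s n : word_eval f (nseq n (s, false)) = f s ^+ n.
Proof. by elim: n => [|n IH]; [exact: big_nil|rewrite /= word_eval_cons IH expgS]. Qed.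

Definition word_eqn u v := u ++ word_inv v.

Lemma word_eqnP f u v : word_eval f (word_eqn u v) = 1 <-> word_eval f u = word_eval f v.
Proof.
rewrite word_eval_cat word_eval_inv; split=> [/divg1_eq //|->]; exact: mulgV.
Qed.

Lemma word_commP f u v :
  word_eval f (word_eqn (u ++ v) (v ++ u)) = 1 <-> commute (word_eval f u) (word_eval f v).
Proof. by rewrite word_eqnP !word_eval_cat. Qed.

End WordEval.

Section RaagLift.
Variables (V : finType) (e : rel V) (G : groupType) (f : V -> G).
Hypothesis f_comm : forall s t, e s t -> commute (f s) (f t).

Lemma word_eval_raag_eq u v : raag_eq e u v -> word_eval f u = word_eval f v.
Proof.
elim=> {u v} // [u v w _ -> _ -> //|u u' v v' _ Eu _ Ev|s b|s t st].
- by rewrite !word_eval_cat Eu Ev.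
- by rewrite !word_eval_cons /word_eval big_nil mulg1; case: b; rewrite /= ?mulVg ?mulgV.
- by rewrite !word_eval_cons /word_eval big_nil !mulg1; apply: f_comm.
Qed.

Definition raag_lift (x : raag e) : G := word_eval f (repr x).

Lemma raag_liftE w : raag_lift (raag_class e w) = word_eval f w.
Proof. exact/word_eval_raag_eq/raag_repr_class. Qed.

Lemma raag_lift_gen s : raag_lift (raag_gen e s) = f s.
Proof. by rewrite raag_liftE word_eval_seq1. Qed.

Lemma raag_liftM x y : raag_lift (x * y) = raag_lift x * raag_lift y.
Proof.
have [u ->] := raag_class_surj x; have [v ->] := raag_class_surj y.
have -> : raag_class e u * raag_class e v = raag_class e (u ++ v) by exact: raag_mulE.
by rewrite !raag_liftE word_eval_cat.
Qed.

Lemma raag_lift1 : raag_lift 1 = 1.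
Proof. by apply: (@mulgI _ (raag_lift 1)); rewrite -raag_liftM !mulg1. Qed.

Lemma raag_liftV x : raag_lift x^-1 = (raag_lift x)^-1.
Proof. by apply: (@mulgI _ (raag_lift x)); rewrite -raag_liftM !mulgV raag_lift1. Qed.

End RaagLift.

Lemma raag_class_eval (V : finType) (e : rel V) w :
  raag_class e w = word_eval (@raag_gen V e) w.
Proof.
elim: w => [|[s b] w IH]; first by rewrite /word_eval big_nil.
rewrite word_eval_cons -IH -cat1s.
have -> : raag_class e ([:: (s, b)] ++ w) = raag_class e [:: (s, b)] * raag_class e w.
  by symmetry; apply: raag_mulE.
by congr (_ * _); case: b => //=; symmetry; apply: raag_invE.
Qed.

Lemma raag_commute (V : finType) (e : rel V) :
  (forall s t, s != t -> e s t) -> forall x y : raag e, commute x y.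
Proof.
move=> st; have gens s t : commute (raag_gen e s) (raag_gen e t).
  have [->|/st est] := eqVneq s t; first exact: commute_refl.
  have E u v : raag_class e [:: u] * raag_class e [:: v] = raag_class e [:: u;
    v] by apply: raag_mulE.
  by rewrite /commute /raag_gen !E; apply/raag_classP/raag_eq_comm.
have letters s x : (forall t, commute x (raag_gen e t)) ->
  commute x (word_eval (@raag_gen V e) s).
  move=> xt; apply: commute_prod => -[t b] _ /=; case: b => //; exact/commuteV.
move=> x y; rewrite -(raag_reprK x) -(raag_reprK y) !raag_class_eval.
by apply: (letters) => t; apply/commute_sym/(letters _ _) => u.
Qed.

(** Send [s] and [t] to the standard generators of the Heisenberg group and every other vertex to 1.
    This respects the relations because [s] and [t] are not adjacent; [p] and [q] are the two
    coordinates modulo the centre. *)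
Lemma raag_coordinates (V : finType) (e : rel V) (e_sym : symmetric e) (s t : V) :
  s != t -> ~~ e s t -> exists p q : raag e -> int,
  [/\ (forall x y, p (x * y) = (p x + p y)%R /\ q (x * y) = (q x + q y)%R),
      (p (raag_gen e s) = 1 /\ q (raag_gen e s) = 0)%R,
      (p (raag_gen e t) = 0 /\ q (raag_gen e t) = 1)%R,
      forall x y, commute x y -> (p x * q y = p y * q x)%R &
      forall x y, ab x = ab y -> p x = p y /\ q x = q y].
Proof.
move=> st nest.
pose f (r : V) : heis := if r == s then ((1, 0, 0)%R : heis) else if r == t then ((0, 1,
  0)%R : heis) else (1 : heis).
have f_comm r r' : e r r' -> commute (f r) (f r').
  rewrite /f; have [->|_] := eqVneq r s; last first.
    have [->|_] := eqVneq r t; last by move=> _; apply/commute_sym/commute1.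
    have [->|_] := eqVneq r' s; first by rewrite e_sym (negbTE nest).
    by case: ifP => _ _; [apply: commute_refl|apply: commute1].
  have [_ _|_] := eqVneq r' s; first exact: commute_refl.
  by have [->|_ _] := eqVneq r' t; [rewrite (negbTE nest)|apply: commute1].
pose F := raag_lift (e := e) f.
have FM x y : F (x * y) = F x * F y by apply: raag_liftM.
have FV x : F x^-1 = (F x)^-1 by apply: raag_liftV.
have F1 : F 1 = 1 by apply: raag_lift1.
exists (fun x => (F x).1.1), (fun x => (F x).1.2); split.
- by move=> x y; rewrite FM.
- by rewrite /F raag_lift_gen // /f eqxx.
- by rewrite /F raag_lift_gen // /f eqxx eq_sym (negbTE st).
- by move=> x y xy; apply: heis_commute; rewrite /commute -!FM xy.
have der z : derived z -> (F z).1.1 = 0%R /\ (F z).1.2 = 0%R.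
  elim=> [|x y _ [xp xq] _ [yp yq]|x _ [xp xq]|x y].
  - by rewrite F1.
  - by rewrite FM /= xp xq yp yq !addr0.
  - by rewrite FV /= xp xq !oppr0.
  - have -> : [~ x, y] = x^-1 * (y^-1 * (x * y)) by rewrite commgEl conjgE.
    by rewrite !FM !FV /=; split; ring.
move=> x y /abP /der; rewrite FM FV /= => -[/eqP xp /eqP xq].
split; apply/eqP; rewrite eq_sym -subr_eq0; [move: xp|move: xq]; by rewrite addrC.
Qed.

Lemma expgM_comm (G : groupType) (x y : G) (n : nat) : commute x y -> commute (x ^+ n) y.
Proof. by move=> xy; apply/commute_sym/commuteX/commute_sym. Qed.

Lemma ab_commute (G : groupType) (x y : abelianisation G) : commute x y.
Proof.
have [u ->] := ab_surj x; have [v ->] := ab_surj y.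
rewrite /commute -!gmulfM; apply/abP.
have -> : (u * v)^-1 * (v * u) = [~ v, u] by rewrite commgEl conjgE invgM !mulgA.
exact: derivedR.
Qed.

Lemma abM (G : groupType) (x y : G) : ab (x * y) = ab x * ab y.
Proof. exact: gmulfM. Qed.

Lemma abX (G : groupType) (x : G) n : ab (x ^+ n) = ab x ^+ n.
Proof. exact: gmulfXn. Qed.

(** * The system of equations *)

Section Reduction.
Variables (V : finType) (e : rel V) (s t : V).
Variables (T : finType) (sys : seq (atom T)) (x0 : T).

(** Each unknown [i] of the arithmetic system gets three group variables [X], [B], [U], numbered 0,
    1, 2, and each pair of unknowns one variable [W]. *)
Definition gvar_type := ((T * 'I_3) + (T * T))%type.
Definition gvar_nb := #|{: gvar_type}|.
Implicit Types (i j : T).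

Definition gvar (x : gvar_type) : word (V + 'I_gvar_nb) := [:: (inr (enum_rank x), false)].
Definition gconst (r : V) : word (V + 'I_gvar_nb) := [:: (inl r, false)].
Definition gX i := gvar (inl (i, inord 0)).
Definition gB i := gvar (inl (i, inord 1)).
Definition gU i := gvar (inl (i, inord 2)).
Definition gW i j := gvar (inr (i, j)).

Definition comm_eqn (u v : word (V + 'I_gvar_nb)) := word_eqn (u ++ v) (v ++ u).

Definition red_eqs : seq (word (V + 'I_gvar_nb)) :=
  flatten [seq [:: comm_eqn (gX i) (gconst s); comm_eqn (gB i) (gconst t);
                   comm_eqn (gU i) (gconst s ++ gconst t)] | i <- enum T] ++
  [seq comm_eqn (gW ij.1 ij.2) (gX ij.1 ++ gconst t) | ij <- enum {: T * T}].

Definition atom_eqn (A : atom T) : word (V + 'I_gvar_nb) :=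
  match A with
  | AOne i => word_eqn (gX i) (gconst s)
  | AAdd i j k => word_eqn (gX i) (gX j ++ gX k)
  | AMul i j k => word_eqn (gW j k) (gX i ++ gB k)
  end.

Definition red_abeqs : seq (word (V + 'I_gvar_nb)) :=
  [seq word_eqn (gU i) (gX i ++ gB i) | i <- enum T] ++ map atom_eqn sys.

(** The parameter enters through [X^-1 s^n] alone, as [n] copies of one letter, so the code of the
    instance is a Diophantine function of [n]. *)
Definition param_eqn n : word (V + 'I_gvar_nb) :=
  (inr (enum_rank (inl (x0, inord 0) : gvar_type)), true) :: nseq n (inl s, false).

Definition red_instance n := DPInstance red_eqs (param_eqn n :: red_abeqs).

Lemma red_complete (v : T -> nat) : sys_sat v sys ->
  dp_solvable (@raag_gen V e) (red_instance (v x0)).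
Proof.
move=> vs; set a := raag_gen e s; set b := raag_gen e t.
pose g (x : gvar_type) : raag e :=
  match x with
  | inl (i, c) => nth 1 [:: a ^+ v i; b ^+ v i; (a * b) ^+ v i] c
  | inr (i, j) => (a ^+ v i * b) ^+ v j
  end.
exists (fun k : 'I_gvar_nb => g (enum_val k)); split=> /= w.
  have gE x : eqn_eval (@raag_gen V e) (fun k : 'I_gvar_nb => g (enum_val k)) (gvar x) = g x.
    by rewrite /eqn_eval word_eval_seq1 /= enum_rankK.
  have cE r : eqn_eval (@raag_gen V e) (fun k : 'I_gvar_nb =>
    g (enum_val k)) (gconst r) = raag_gen e r.
    by rewrite /eqn_eval word_eval_seq1.
  have catE u u' : eqn_eval (@raag_gen V e) (fun k : 'I_gvar_nb => g (enum_val k)) (u ++ u') =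
      eqn_eval (@raag_gen V e) (fun k : 'I_gvar_nb => g (enum_val k)) u *
      eqn_eval (@raag_gen V e) (fun k : 'I_gvar_nb => g (enum_val k)) u'
        by apply: word_eval_cat.
  rewrite mem_cat => /orP[/flatten_mapP[i _]|/mapP[[i j] _ ->]].
    rewrite !inE => /or3P[] /eqP ->; apply/word_commP;
      rewrite -!/(eqn_eval _ _ _) ?catE !gE !cE /= inordK //=;
      exact/expgM_comm/commute_refl.
  apply/word_commP; rewrite -!/(eqn_eval _ _ _) catE !gE !cE /= inordK //=.
  exact/expgM_comm/commute_refl.
pose ev := eqn_eval (@ab (raag e) \o @raag_gen V e) (@ab (raag e) \o (fun k : 'I_gvar_nb =>
  g (enum_val k))).
have gE x : ev (gvar x) = ab (g x) by rewrite /ev /eqn_eval word_eval_seq1 /= enum_rankK.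
have cE r : ev (gconst r) = ab (raag_gen e r) by rewrite /ev /eqn_eval word_eval_seq1.
have catE u u' : ev (u ++ u') = ev u * ev u' by apply: word_eval_cat.
rewrite -/(ev w) inE => /predU1P[->|].
  rewrite /ev /eqn_eval word_eval_cons word_eval_nseq /= enum_rankK /= inordK //=.
  by rewrite gmulfXn mulVg.
rewrite mem_cat => /orP[/mapP[i _ ->]|].
  apply/word_eqnP; rewrite -![word_eval _ _]/(ev _) catE !gE /= !inordK //= !gmulfXn gmulfM.
  exact/expgMn/ab_commute.
suff /allP H : all (fun w => ev w == 1) (map atom_eqn sys) by move=> /H/eqP.
rewrite all_map; apply: sub_all vs => A HA; apply/eqP; rewrite -/(ev (atom_eqn A)).
case: A HA => [i|i j k|i j k] /eqP HA; apply/word_eqnP;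
  rewrite -![word_eval _ _]/(ev _) ?catE !gE ?cE /= ?inordK //= HA //.
  by rewrite -gmulfM expgnDr.
by rewrite !gmulfXn gmulfM expgMn ?gmulfXn ?expgnA //; apply: ab_commute.
Qed.

Lemma red_sound n : symmetric e -> s != t -> ~~ e s t ->
  dp_solvable (@raag_gen V e) (red_instance n) ->
  exists z : T -> int, z x0 = n%:Z%R /\ all (atom_satz z) sys.
Proof.
move=> e_sym st nest [/= g [geqs gabs]].
have [p [q [pqM [ps qs] [pt qt] comm abpq]]] := raag_coordinates e_sym st nest.
have pM x y : p (x * y) = (p x + p y)%R by case: (pqM x y).
have qM x y : q (x * y) = (q x + q y)%R by case: (pqM x y).
set ev := eqn_eval (@raag_gen V e) g in geqs.
pose G x := g (enum_rank (x : gvar_type)).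
have gE x : ev (gvar x) = G x by rewrite /ev /eqn_eval word_eval_seq1.
have cE r : ev (gconst r) = raag_gen e r by rewrite /ev /eqn_eval word_eval_seq1.
have catE u u' : ev (u ++ u') = ev u * ev u' by apply: word_eval_cat.
have commE u u' : comm_eqn u u' \in red_eqs -> commute (ev u) (ev u').
  by move=> /geqs /word_commP.
have mem3 i u : u \in [:: comm_eqn (gX i) (gconst s); comm_eqn (gB i) (gconst t);
    comm_eqn (gU i) (gconst s ++ gconst t)] -> u \in red_eqs.
  move=> ui; rewrite mem_cat; apply/orP; left; apply/flatten_mapP.
  by exists i => //; rewrite mem_enum.
pose X i := G (inl (i, inord 0)); pose B i := G (inl (i, inord 1)).
pose U i := G (inl (i, inord 2)); pose W i j := G (inr (i, j)).
have Xs i : commute (X i) (raag_gen e s).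
  by rewrite -(cE s) -[X i]gE; apply/commE/(mem3 i); rewrite !inE eqxx.
have Bt i : commute (B i) (raag_gen e t).
  by rewrite -(cE t) -[B i]gE; apply/commE/(mem3 i); rewrite !inE eqxx orbT.
have Ust i : commute (U i) (raag_gen e s * raag_gen e t).
  by rewrite -(cE s) -(cE t) -catE -[U i]gE; apply/commE/(mem3 i); rewrite !inE eqxx !orbT.
have WX i j : commute (W i j) (X i * raag_gen e t).
  rewrite -(cE t) -[X i]gE -catE -[W i j]gE; apply/commE; rewrite mem_cat; apply/orP; right.
  by apply/mapP; exists (i, j); rewrite ?mem_enum.
pose eva := eqn_eval (@ab (raag e) \o @raag_gen V e) (@ab (raag e) \o g).
have aE x : eva (gvar x) = ab (G x) by rewrite /eva /eqn_eval word_eval_seq1.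
have acE r : eva (gconst r) = ab (raag_gen e r) by rewrite /eva /eqn_eval word_eval_seq1.
have acatE u u' : eva (u ++ u') = eva u * eva u' by apply: word_eval_cat.
have eqnE u u' : word_eqn u u' \in red_abeqs -> eva u = eva u'.
  by move=> uu; apply/word_eqnP/gabs; rewrite inE uu orbT.
have UXB i : ab (U i) = ab (X i * B i).
  rewrite abM -[ab (U i)]aE -[ab (X i)]aE -[ab (B i)]aE -acatE; apply: eqnE.
  by rewrite mem_cat; apply/orP; left; apply/mapP; exists i; rewrite ?mem_enum.
have qX i : q (X i) = 0%R by have := comm _ _ (Xs i); rewrite ps qs; lia.
have pB i : p (B i) = 0%R by have := comm _ _ (Bt i); rewrite pt qt; lia.
have qB i : q (B i) = p (X i).
  have [E1 E2] := abpq _ _ (UXB i); rewrite pM qM pB qX in E1 E2.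
  (* [U] has coordinates [(p (X i), q (B i))], collinear with the coordinates [(1, 1)] of [s t]. *)
  by have := comm _ _ (Ust i); rewrite pM qM ps qs pt qt E1 E2; lia.
exists (fun i => p (X i)); split.
  have := gabs (param_eqn n); rewrite inE eqxx => /(_ isT).
  rewrite /param_eqn /eqn_eval word_eval_cons word_eval_nseq /= -abX.
  move=> E; have /abpq[-> _] : ab (X x0) = ab (raag_gen e s ^+ n).
    by apply: (@mulgI _ (ab (X x0))^-1); rewrite E mulVg.
  by elim: (n) => [|k IH]; [have := pM 1 1; rewrite expg0 mulg1; lia|rewrite expgS pM IH ps;
    lia].
have : all (fun w => eva w == 1) (map atom_eqn sys).
  by apply/allP => w ws; apply/eqP/gabs; rewrite inE mem_cat ws !orbT.
rewrite all_map; apply: sub_all => A /eqP EA; have {EA} : eva (atom_eqn A) = 1 by [].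
case: A => [i|i j k|i j k] /word_eqnP;
  rewrite -![word_eval _ _]/(eva _) ?acatE !aE ?acE -?abM => /abpq[]; rewrite -/(X _).
- by rewrite ps => E _ /=; apply/eqP.
- by rewrite pM => E _ /=; apply/eqP.
rewrite pM qM pB qB qX => Wp Wq /=; apply/eqP.
(* With [x = p \o X], [W j k] has coordinates [(x i, x k)], collinear with the coordinates
   [(x j, 1)] of [X j] times [t]. *)
by have := comm _ _ (WX j k); rewrite pM qM pt qt qX Wp Wq; lia.
Qed.

End Reduction.

Local Close Scope group_scope.

(** * Diagonal argument *)

Lemma dfun_npair f g : dfun f -> dfun g -> dfun (fun v => npair (f v) (g v)).
Proof.
move=> df dg; apply: dfunD => //; apply: dfun_bin; last exact: dfun_const.
exact/dfunS/dfunD.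
Qed.

Definition nseq_code (c n : nat) := iter n (fun z => (npair c z).+1) 0.

Lemma code_seq_nseq T (c : T -> nat) x n : code_seq c (nseq n x) = nseq_code (c x) n.
Proof. by elim: n => //= n ->. Qed.

Lemma dfun_nseq_code c f : dfun f -> dfun (fun v => nseq_code c (f v)).
Proof.
apply: (dfun_comp1 (F := nseq_code c)).
have := @dioph_rec (fun z _ => z = 0) (fun _ z z' _ => z' = (npair c z).+1)
  (fun v => v 1) (fun v => v 0) _ _ (dfun_var 1) (dfun_var 0).
move=> H; apply: dioph_iff (H _ _) => [v||]; last 2 first.
- by dio.
- by apply: dioph_eq; [dio|apply/dfunS/dfun_npair; dio].
split=> [E|[h [h0 hS ->]]]; first by exists (nseq_code c); split.
elim: (v 1) hS => [|n IH] hS; first by rewrite h0.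
by rewrite hS //= IH // => m mn; apply: hS; apply: ltnW.
Qed.

(** The code of an instance from the letter code [c] of [s], the rank [r] of the parameter variable,
    the number [K] of group variables, and the codes [E], [D] of the equations and the fixed
    constraints. The exponent of [s] is the number that codes [(r, K, E, D)]: the instance receives
    its own description. *)
Definition diag_code (c r K E D : nat) :=
  npair K (npair E (npair (npair (npair (npair 1 r) 1)
    (nseq_code c (npair r (npair K (npair E D))))).+1 D).+1).

Lemma dp_code_red_instance (V : finType) (s t : V) (T : finType) (sys : seq (atom T)) x0 r K E
  D :
  r = enum_rank (inl (x0, inord 0) : gvar_type T) ->
  K = gvar_nb T -> E = code_seq (code_seq (@code_letter V _)) (red_eqs s t T) ->
  D = code_seq (code_seq (@code_letter V _)) (red_abeqs s sys) ->
  dp_code (red_instance s t sys x0 (npair r (npair K (npair E D)))) =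
  diag_code (npair (npair 0 (enum_rank s)) 0) r K E D.
Proof.
by move=> -> -> -> ->; rewrite /dp_code /diag_code /= code_seq_nseq.
Qed.

Theorem theorem1 (V : finType) (e : rel V)
    (e_sym : symmetric e) (e_irr : irreflexive e)
    (nonabelian : ~ (forall x y : raag e, commute x y)) :
  ~ rec_decidable (@dp_code V) (dp_solvable (@raag_gen V e)).
Proof.
move=> [f fP].
have [s [t [st nest]]] : exists s t, s != t /\ ~~ e s t.
  apply: contrapT => H; apply: nonabelian; apply: raag_commute => s t st.
  by apply: contrapT => /negP nest; apply: H; exists s, t.
pose c := npair (npair 0 (enum_rank s)) 0.
(* [R n]: the algorithm rejects the instance described by [n] with parameter [n]. *)
pose R n := exists r K E D, n = npair r (npair K (npair E D)) /\
  computes f (tuple_of_env 1 (fun=> diag_code c r K E D)) 0.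
have dR : dioph (fun v => R (v 0)).
  rewrite /R; do 4 apply: dioph_ex; apply: dioph_and.
    by apply: dioph_eq; first (by dio); do ![apply: dfun_npair]; dio.
  apply: dioph_computes_subst; [exact: dioph_computes| |by dio].
  move=> i _; rewrite /diag_code.
  have d1 := dfun_nseq_code c (dfun_npair (dfun_var 3) (dfun_npair (dfun_var 2) (dfun_npair
    (dfun_var 1) (dfun_var 0)))).
  by do ![apply: dfunS || apply: dfun_npair || assumption || apply: dfun_var || apply:
    dfun_const].
have [N [sys0 sysP]] := dioph_finite dR.
pose sys := four_squares_sys sys0; pose x0 : 'I_N.+1 * 'I_11 := (ord0, ord0).
pose r : nat := enum_rank (inl (x0, inord 0) : gvar_type _).
pose K := gvar_nb ('I_N.+1 * 'I_11)%type.
pose E := code_seq (code_seq (@code_letter V _)) (red_eqs s t ('I_N.+1 * 'I_11)%type).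
pose D := code_seq (code_seq (@code_letter V _)) (red_abeqs s sys).
(* [n0] describes the reduction of the system that defines [R], so [I0] is solvable exactly when
   [R n0] holds, that is, when [f] rejects [I0]. *)
pose n0 := npair r (npair K (npair E D)).
pose I0 := red_instance s t sys x0 n0.
have codeI : [tuple dp_code I0] = tuple_of_env 1 (fun=> diag_code c r K E D).
  apply: eq_from_tnth => i; rewrite tnth_mktuple ord1 tnth0.
  exact: dp_code_red_instance.
have RE : R n0 <-> computes f [tuple dp_code I0] 0.
  rewrite codeI; split=> [|H]; last by exists r, K, E, D.
  by move=> [r' [K' [E' [D' [/npair_inj[<- /npair_inj[<- /npair_inj[<- <-]]]]]]]].
have solvR : R n0 <-> dp_solvable (@raag_gen V e) I0.
  rewrite sysP; split=> [[v [vn vs]]|].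
    have [w [wv ws]] := four_squares_nat vs.
    by have := red_complete e s t x0 ws; rewrite wv vn.
  move=> /(red_sound e_sym st nest)[z [zn zs]].
  have [v [vz vs]] := four_squares_int zs; exists v; split=> //.
  by have := vz ord0; rewrite zn => -[].
have [f1 f0] := fP I0.
have nsolv : ~ dp_solvable (@raag_gen V e) I0.
  by move=> sol; have := computes_inj (f1 sol) (RE.1 (solvR.2 sol)).
exact/nsolv/solvR/RE/f0.
Qed.
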